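(* Assume $(A,B_2)$ and $(A,W^{1/2})$ are controllable and $(C_2,A)$ and $(Q^{1/2},A)$ are observable. Then for every $\gamma>0$ the strict sublevel set $\mathcal{L}_\gamma=\{K\in\mathcal{C}_{stab}: D_K=0,\ \|\mathbf{T}_{zw}\|_2^2<\gamma\}$ has at most two path-connected components. If it has two path-connected components $\mathcal{L}_\gamma^{(1)}$ and $\mathcal{L}_\gamma^{(2)}$, then they are diffeomorphic under the mapping $\mathscr{T}_T$ for any invertible $T\in\mathbb{R}^{n_x\times n_x}$ with $\det T<0$.
   Context: LQG setting: consider the continuous-time plant $\dot x=Ax+B_1w+B_2u$, $z=C_1x+D_{11}w+D_{12}u$, $y=C_2x+D_{21}w$ with $A\in\mathbb{R}^{n_x\times n_x}$, $B_2\in\mathbb{R}^{n_x\times n_u}$, $C_2\in\mathbb{R}^{n_y\times n_x}$, and, for given $W\succeq0$ ($n_x\times n_x$), $V\succ0$ ($n_y\times n_y$), $Q\succeq0$ ($n_x\times n_x$), $R\succ0$ ($n_u\times n_u$): $B_1=\begin{bmatrix}W^{1/2} & 0\end{bmatrix}$, $C_1=\begin{bmatrix}Q^{1/2}\\ 0\end{bmatrix}$, $D_{11}=0$, $D_{12}=\begin{bmatrix}0\\ R^{1/2}\end{bmatrix}$, $D_{21}=\begin{bmatrix}0 & V^{1/2}\end{bmatrix}$. A full-order controller $\dot\xi=A_K\xi+B_Ky$, $u=C_K\xi+D_Ky$, $\xi\in\mathbb{R}^{n_x}$, is identified with $K=\begin{bmatrix}D_K & C_K\\ B_K & A_K\end{bmatrix}$.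 Closed-loop matrices: $A_{cl}=\begin{bmatrix}A+B_2D_KC_2 & B_2C_K\\ B_KC_2 & A_K\end{bmatrix}$, $B_{cl}=\begin{bmatrix}B_1+B_2D_KD_{21}\\ B_KD_{21}\end{bmatrix}$, $C_{cl}=\begin{bmatrix}C_1+D_{12}D_KC_2 & D_{12}C_K\end{bmatrix}$, $D_{cl}=D_{11}+D_{12}D_KD_{21}$; $\mathcal{C}_{stab}$ is the set of $K$ with $A_{cl}$ Hurwitz; $\mathbf{T}_{zw}(s)=C_{cl}(sI-A_{cl})^{-1}B_{cl}+D_{cl}$ and $\|\cdot\|_2$ is the $\mathcal{H}_2$ norm. For invertible $T$, $\mathscr{T}_T(K)=\begin{bmatrix}D_K & C_KT^{-1}\\ TB_K & TA_KT^{-1}\end{bmatrix}$. *)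

(* Defs.v *)
From HB Require Import structures.
From mathcomp Require Import all_boot all_order all_algebra.
From mathcomp Require Import all_classical all_reals all_analysis.
From mathcomp Require Import complex.
Set Implicit Arguments. Unset Strict Implicit. Unset Printing Implicit Defensive.
Import Order.TTheory GRing.Theory Num.Theory.
Import numFieldNormedType.Exports.
Local Open Scope classical_set_scope.
Local Open Scope ring_scope.

Definition to_C {R : rcfType} (x : R) : R[i] := Complex x 0.
Definition mxC {R : rcfType} {m n} (M : 'M[R]_(m, n)) : 'M[R[i]]_(m, n) :=
  map_mx (@to_C R) M.
Definition ctrmx {R : rcfType} {m n} (M : 'M[R[i]]_(m, n)) : 'M[R[i]]_(n, m) :=
  (map_mx (@conjc R) M)^T.

Definition hurwitz {R : rcfType} {n} (A : 'M[R]_n) : Prop :=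
  forall z : R[i], root (char_poly (mxC A)) z -> complex.Re z < 0.

Definition psd {R : realFieldType} {n} (M : 'M[R]_n) : Prop :=
  M^T = M /\ forall x : 'cV[R]_n, 0 <= (x^T *m M *m x) 0 0.
Definition pd {R : realFieldType} {n} (M : 'M[R]_n) : Prop :=
  M^T = M /\ forall x : 'cV[R]_n, x != 0 -> 0 < (x^T *m M *m x) 0 0.
Definition is_psd_sqrt {R : realFieldType} {n} (Mh M : 'M[R]_n) : Prop :=
  psd Mh /\ Mh *m Mh = M.

(* rank [B, AB, ..., A^(n-1) B] = n  (column space = row space of the transposes) *)
Definition controllable {R : fieldType} {n m} (A : 'M[R]_n) (B : 'M[R]_(n, m)) : Prop :=
  \rank (\sum_(i < n) <<(A ^+ i *m B)^T>>)%MS = n.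
Definition observable {R : fieldType} {n p} (C : 'M[R]_(p, n)) (A : 'M[R]_n) : Prop :=
  \rank (\sum_(i < n) <<C *m A ^+ i>>)%MS = n.

Section Plant.
Variables (R : realType) (nx nu ny : nat).
Variables (A : 'M[R]_nx) (B2 : 'M[R]_(nx, nu)) (C2 : 'M[R]_(ny, nx)).
Variables (Wh Qh : 'M[R]_nx) (Vh : 'M[R]_ny) (Rh : 'M[R]_nu).

Definition B1 : 'M[R]_(nx, nx + ny) := row_mx Wh 0.
Definition C1 : 'M[R]_(nx + nu, nx) := col_mx Qh 0.
Definition D11 : 'M[R]_(nx + nu, nx + ny) := 0.
Definition D12 : 'M[R]_(nx + nu, nu) := col_mx 0 Rh.
Definition D21 : 'M[R]_(ny, nx + ny) := row_mx 0 Vh.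

Definition DK (K : 'M[R]_(nu + nx, ny + nx)) : 'M[R]_(nu, ny) := ulsubmx K.
Definition CK (K : 'M[R]_(nu + nx, ny + nx)) : 'M[R]_(nu, nx) := ursubmx K.
Definition BK (K : 'M[R]_(nu + nx, ny + nx)) : 'M[R]_(nx, ny) := dlsubmx K.
Definition AK (K : 'M[R]_(nu + nx, ny + nx)) : 'M[R]_(nx, nx) := drsubmx K.

Definition Acl (K : 'M[R]_(nu + nx, ny + nx)) : 'M[R]_(nx + nx) :=
  block_mx (A + B2 *m DK K *m C2) (B2 *m CK K) (BK K *m C2) (AK K).
Definition Bcl (K : 'M[R]_(nu + nx, ny + nx)) : 'M[R]_(nx + nx, nx + ny) :=
  col_mx (B1 + B2 *m DK K *m D21) (BK K *m D21).
Definition Ccl (K : 'M[R]_(nu + nx, ny + nx)) : 'M[R]_(nx + nu, nx + nx) :=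
  row_mx (C1 + D12 *m DK K *m C2) (D12 *m CK K).
Definition Dcl (K : 'M[R]_(nu + nx, ny + nx)) : 'M[R]_(nx + nu, nx + ny) :=
  D11 + D12 *m DK K *m D21.

Definition Tzw (K : 'M[R]_(nu + nx, ny + nx)) (w : R) : 'M[R[i]]_(nx + nu, nx + ny) :=
  mxC (Ccl K) *m invmx ((Complex 0 w)%:M - mxC (Acl K)) *m mxC (Bcl K) + mxC (Dcl K).

Definition h2norm_sq (K : 'M[R]_(nu + nx, ny + nx)) : \bar R :=
  ((2 * pi)^-1)%:E *
  (\int[lebesgue_measure]_(w in [set: R]) (complex.Re (\tr (ctrmx (Tzw K w) *m Tzw K w)))%:E)%E.

Definition Cstab : set 'M[R]_(nu + nx, ny + nx) := [set K | hurwitz (Acl K)].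

Definition Lgamma (gamma : R) : set 'M[R]_(nu + nx, ny + nx) :=
  [set K | Cstab K /\ DK K = 0 /\ (h2norm_sq K < gamma%:E)%E].

End Plant.

Definition scrT {R : realType} {nx nu ny} (T : 'M[R]_nx) (K : 'M[R]_(nu + nx, ny + nx))
  : 'M[R]_(nu + nx, ny + nx) :=
  block_mx (DK K) (CK K *m invmx T) (T *m BK K) (T *m AK K *m invmx T).

Definition path_in {R : realType} {T : topologicalType} (S : set T) (x y : T) : Prop :=
  exists p : R -> T, {within `[0, 1], continuous p} /\ p 0 = x /\ p 1 = y /\
    (forall t : R, 0 <= t <= 1 -> S (p t)).

Definition path_component {R : realType} {T : topologicalType} (S : set T) (x : T) : set T :=
  [set y | S x /\ @path_in R T S x y].

(* Main.v *)
(* If A is Hurwitz and A X + X A^T = - M, the resolvent R = (i w - A)^-1 satisfies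
   R M R^* = R X + X R^*, and the principal value of the integral of tr (R Y) over
   the frequencies w is pi tr Y. Hence the Lyapunov equation is solvable, its solution
   is positive definite when M is, and the squared H2 norm is tr (C X C^T). So K lies
   in the sublevel set iff D_K = 0 and some S > 0 satisfies the strict inequalities
   A_cl S + S A_cl^T + B_cl B_cl^T < 0 and tr (C_cl S C_cl^T) < gamma. By strictness
   the off-diagonal block of S can be made invertible, and a similarity transform
   normalizes it to the identity. In Scherer's variables the normalized controllers are
   a continuous image of a convex set, so any controller of the sublevel set is joined
   by a path to a transform of any other one. The statement follows because the path
   components of GL_n(R) are the two signs of the determinant. *)
Require Import Defs.
From HB Require Import structures.
From mathcomp Require Import all_boot all_order all_algebra.
From mathcomp Require Import fingroup perm.
From mathcomp Require Import all_classical all_reals all_analysis.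
From mathcomp Require Import measurable_realfun complex.
From mathcomp Require Import ring lra.
Set Implicit Arguments. Unset Strict Implicit. Unset Printing Implicit Defensive.
Import Order.TTheory GRing.Theory Num.Theory.
Import numFieldNormedType.Exports.
Local Open Scope classical_set_scope.
Local Open Scope ring_scope.

(** * Principal value integrals along the imaginary axis *)

Section PrincipalValue.
Variable R : realType.
Implicit Types (f g F G : R -> R[i]) (c a l : R[i]) (w : R).
Local Notation Re := (@complex.Re R).
Local Notation Im := (@complex.Im R).

(** For large frequencies the trace [tr (R Y)] decays only like [1 / w], so it need not be
    absolutely integrable and only symmetric limits make sense. Every such trace is reduced to
    products of scalars [1 / (i w - l)] with explicit antiderivatives, which replaces both contour
    integration and the matrix exponential. The set of Lyapunov certificates [S] is not convex
    jointly with the controller, because [A_cl S] is bilinear. The linearizing variables remove the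
    bilinearity, but recovering a controller from them requires a choice of the off-diagonal block
    of [S], and this choice is exactly the freedom of a similarity transform. Fixing the block to be
    the identity makes the recovery a single continuous map. The price is that two controllers are
    joined only after each has been moved by some invertible matrix of unknown determinant sign;
    this sign is the sole source of a second component. *)

Lemma ReD (x y : R[i]) : Re (x + y) = Re x + Re y. Proof. by case: x; case: y. Qed.
Lemma ImD (x y : R[i]) : Im (x + y) = Im x + Im y. Proof. by case: x; case: y. Qed.
Lemma ReN (x : R[i]) : Re (- x) = - Re x. Proof. by case: x. Qed.
Lemma ReM (x y : R[i]) : Re (x * y) = Re x * Re y - Im x * Im y.
Proof. by case: x; case: y. Qed.
Lemma ImM (x y : R[i]) : Im (x * y) = Re x * Im y + Im x * Re y.
Proof. by case: x => a b; case: y => c d. Qed.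

(** Real and imaginary parts are differentiated separately in the real variable, so that only real
    calculus is involved. *)
Definition cderive F f := forall w,
  is_derive w 1 (Re \o F) (Re (f w)) /\ is_derive w 1 (Im \o F) (Im (f w)).

Lemma cderiveM F G f g : cderive F f -> cderive G g ->
  cderive (fun w => F w * G w) (fun w => f w * G w + F w * g w).
Proof.
move=> dF dG w; have [F1 F2] := dF w; have [G1 G2] := dG w; split.
- have -> : Re \o (fun w => F w * G w) =
     (Re \o F) * (Re \o G) - (Im \o F) * (Im \o G).
    by apply/funext => t; rewrite /= ReM.
  apply: (is_derive_eq (is_deriveB (is_deriveM F1 G1) (is_deriveM F2 G2))).
  rewrite /GRing.scale /= ReD !ReM.
  by move: (Re _) (Im _) (Re _) (Im _) (Re _) (Im _) (Re _) (Im _) => *; ring.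
- have -> : Im \o (fun w => F w * G w) =
     (Re \o F) * (Im \o G) + (Im \o F) * (Re \o G).
    by apply/funext => t; rewrite /= ImM.
  apply: (is_derive_eq (is_deriveD (is_deriveM F1 G2) (is_deriveM F2 G1))).
  rewrite /GRing.scale /= ImD !ImM.
  by move: (Re _) (Im _) (Re _) (Im _) (Re _) (Im _) (Re _) (Im _) => *; ring.
Qed.

Lemma cderive_cst c : cderive (fun=> c) (fun=> 0).
Proof.
by move=> w; split; rewrite /comp/=; exact: is_derive_cst.
Qed.

Lemma cderiveD F G f g : cderive F f -> cderive G g ->
  cderive (fun w => F w + G w) (fun w => f w + g w).
Proof.
move=> dF dG w; have [F1 F2] := dF w; have [G1 G2] := dG w; split.
- have -> : Re \o (fun w => F w + G w) = (Re \o F) + (Re \o G).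
    by apply/funext => t; rewrite /= ReD.
  by rewrite ReD; exact: is_deriveD.
- have -> : Im \o (fun w => F w + G w) = (Im \o F) + (Im \o G).
    by apply/funext => t; rewrite /= ImD.
  by rewrite ImD; exact: is_deriveD.
Qed.

Lemma cderiveZ c F f : cderive F f -> cderive (fun w => c * F w) (fun w => c * f w).
Proof.
move=> /(cderiveM (cderive_cst c)) dF w.
by have [] := dF w; rewrite mul0r add0r.
Qed.

Definition ccontinuous f := continuous (Re \o f) /\ continuous (Im \o f).

Lemma is_derive_continuous (h h' : R -> R) : (forall w, is_derive w 1 h (h' w)) ->
  continuous h.
Proof.
move=> dh w; apply: differentiable_continuous; apply/derivable1_diffP.
by have [] := dh w.
Qed.

Lemma cderive_continuous F f : cderive F f -> ccontinuous F.
Proof.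
move=> dF; split.
- by apply: (@is_derive_continuous _ (Re \o f)) => w; have [] := dF w.
- by apply: (@is_derive_continuous _ (Im \o f)) => w; have [] := dF w.
Qed.

Lemma cvg_to_eq (h : R -> R) (a b : R) : h x @[x --> +oo] --> a -> a = b ->
  h x @[x --> +oo] --> b.
Proof. by move=> ? <-. Qed.

Definition ctends0 F := (Re \o F) x @[x --> +oo] --> 0 /\ (Im \o F) x @[x --> +oo] --> 0.

Lemma ctends0M F G : ctends0 F -> ctends0 G -> ctends0 (fun w => F w * G w).
Proof.
move=> [F1 F2] [G1 G2]; split.
- have -> : Re \o (fun w => F w * G w) =
     (Re \o F) * (Re \o G) - (Im \o F) * (Im \o G).
    by apply/funext => t; rewrite /= ReM.
  apply: (@cvg_to_eq _ (0 * 0 - 0 * 0)); last by rewrite !mul0r subr0.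
  by apply: cvgB; apply: cvgM.
- have -> : Im \o (fun w => F w * G w) =
     (Re \o F) * (Im \o G) + (Im \o F) * (Re \o G).
    by apply/funext => t; rewrite /= ImM.
  apply: (@cvg_to_eq _ (0 * 0 + 0 * 0)); last by rewrite !mul0r addr0.
  by apply: cvgD; apply: cvgM.
Qed.

Lemma ctends0D F G : ctends0 F -> ctends0 G -> ctends0 (fun w => F w + G w).
Proof.
move=> [F1 F2] [G1 G2]; split.
- have -> : Re \o (fun w => F w + G w) = (Re \o F) + (Re \o G).
    by apply/funext => t; rewrite /= ReD.
  apply: (@cvg_to_eq _ (0 + 0)); last by rewrite addr0.
  exact: cvgD.
- have -> : Im \o (fun w => F w + G w) = (Im \o F) + (Im \o G).
    by apply/funext => t; rewrite /= ImD.
  apply: (@cvg_to_eq _ (0 + 0)); last by rewrite addr0.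
  exact: cvgD.
Qed.

Lemma ctends0Z c F : ctends0 F -> ctends0 (fun w => c * F w).
Proof.
move=> [F1 F2]; split.
- have -> : Re \o (fun w => c * F w) = (Re c \*: (Re \o F)) - (Im c \*: (Im \o F)).
    by apply/funext => t; rewrite /= ReM.
  apply: (@cvg_to_eq _ (Re c *: 0 - Im c *: 0)); last by rewrite !scaler0 subr0.
  by apply: cvgB; apply: cvgZr.
- have -> : Im \o (fun w => c * F w) = (Re c \*: (Im \o F)) + (Im c \*: (Re \o F)).
    by apply/funext => t; rewrite /= ImM.
  apply: (@cvg_to_eq _ (Re c *: 0 + Im c *: 0)); last by rewrite !scaler0 addr0.
  by apply: cvgD; apply: cvgZr.
Qed.

(* [pi * c] is the principal value of the integral of [f] over the real line. Going
   through antiderivatives allows conditionally convergent [f]; integrals appear only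
   for the nonnegative integrand of [pvint_integral]. *)
Definition pvint f c := ccontinuous f /\ exists2 F, cderive F f &
  ctends0 (fun w => F w - F (- w) - to_C pi * c).

Lemma pvintD f g c d : pvint f c -> pvint g d -> pvint (fun w => f w + g w) (c + d).
Proof.
move=> [[f1 f2] [F dF Fc]] [[g1 g2] [G dG Gd]]; split.
  split.
  - have -> : Re \o (fun w => f w + g w) = (Re \o f) + (Re \o g).
      by apply/funext => t; rewrite /= ReD.
    by move=> x; apply: cvgD; [exact: f1|exact: g1].
  - have -> : Im \o (fun w => f w + g w) = (Im \o f) + (Im \o g).
      by apply/funext => t; rewrite /= ImD.
    by move=> x; apply: cvgD; [exact: f2|exact: g2].
exists (fun w => F w + G w); first exact: cderiveD.
suff -> : (fun w => F w + G w - (F (- w) + G (- w)) - to_C pi * (c + d)) =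
  (fun w => (F w - F (- w) - to_C pi * c) + (G w - G (- w) - to_C pi * d)).
  exact: ctends0D.
by apply/funext => w; ring.
Qed.

Lemma pvintZ a f c : pvint f c -> pvint (fun w => a * f w) (a * c).
Proof.
move=> [[f1 f2] [F dF Fc]]; split.
  split.
  - have -> : Re \o (fun w => a * f w) = (Re a \*: (Re \o f)) - (Im a \*: (Im \o f)).
      by apply/funext => t; rewrite /= ReM.
    by move=> x; apply: cvgB; apply: cvgZr; [exact: f1|exact: f2].
  - have -> : Im \o (fun w => a * f w) = (Re a \*: (Im \o f)) + (Im a \*: (Re \o f)).
      by apply/funext => t; rewrite /= ImM.
    by move=> x; apply: cvgD; apply: cvgZr; [exact: f2|exact: f1].
exists (fun w => a * F w); first exact: cderiveZ.
suff -> : (fun w => a * F w - (a * F (- w)) - to_C pi * (a * c)) =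
  (fun w => a * (F w - F (- w) - to_C pi * c)).
  exact: ctends0Z.
by apply/funext => w; ring.
Qed.

Lemma eq_pvint f g c : f =1 g -> pvint f c -> pvint g c.
Proof. by move=> /funext ->. Qed.

Lemma pvint0 : pvint (fun=> 0) 0.
Proof.
split; first by split=> x; exact: cvg_cst.
exists (fun=> 0); first exact: cderive_cst.
by rewrite mulr0 !subr0; split; exact: cvg_cst.
Qed.

(** * Simple and multiple poles in the open left half-plane *)

Definition cpole l w : R[i] := ((Complex 0 w) - l)^-1.

Lemma Re_cpole l w : Re (cpole l w) = - Re l / (Re l ^+ 2 + (w - Im l) ^+ 2).
Proof. by case: l => a b /=; rewrite sub0r sqrrN. Qed.

Lemma Im_cpole l w : Im (cpole l w) = - ((w - Im l) / (Re l ^+ 2 + (w - Im l) ^+ 2)).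
Proof. by case: l => a b /=; rewrite sub0r sqrrN. Qed.

Lemma cpole_den l w : Re l < 0 -> 0 < Re l ^+ 2 + (w - Im l) ^+ 2.
Proof. by move=> l0; rewrite ltr_pwDl ?sqr_ge0// exprn_even_gt0//= lt_eqF. Qed.

Lemma cpole_neq0 l w : Re l < 0 -> Complex 0 w - l != 0.
Proof.
case: l => a b /= l0; apply/eqP => -[/eqP]; rewrite sub0r oppr_eq0 => /eqP a0.
by rewrite a0 ltxx in l0.
Qed.

Lemma cderive_cpole l : Re l < 0 ->
  cderive (cpole l) (fun w => Complex 0 (-1) * cpole l w ^+ 2).
Proof.
move=> l0 w; have den := cpole_den w l0.
have dm : is_derive w 1 (fun t => t - Im l) 1.
  exact: (is_derive_eq (is_deriveB (is_derive_id w 1) (is_derive_cst (Im l) w 1)) (subr0 1)).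
have dn : is_derive w 1 (fun t => Re l ^+ 2 + (t - Im l) ^+ 2) (2 * (w - Im l)).
  apply: (is_derive_eq (is_deriveD (is_derive_cst (Re l ^+ 2) w 1) (is_deriveM dm dm))).
  by rewrite /GRing.scale/=; ring.
have dV : is_derive w 1 (fun t => (Re l ^+ 2 + (t - Im l) ^+ 2)^-1)
   (- (Re l ^+ 2 + (w - Im l) ^+ 2) ^- 2 * (2 * (w - Im l))).
  apply: is_deriveV; first by rewrite gt_eqF.
rewrite expr2 !(ReM, ImM) Re_cpole Im_cpole /=; split.
- have -> : Re \o cpole l = - Re l \*: (fun t => (Re l ^+ 2 + (t - Im l) ^+ 2)^-1).
    by apply/funext => t; rewrite /= Re_cpole.
  apply: (is_derive_eq (is_deriveZ (- Re l) dV)); rewrite /GRing.scale/=; field.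
  by rewrite gt_eqF.
- have -> : Im \o cpole l =
     - ((fun t => t - Im l) * (fun t => (Re l ^+ 2 + (t - Im l) ^+ 2)^-1)).
    by apply/funext => t; rewrite /= Im_cpole.
  apply: (is_derive_eq (is_deriveN (is_deriveM dm dV))); rewrite /GRing.scale/=; field.
  by rewrite gt_eqF.
Qed.


Lemma cvg_shift_pinfty (c : R) : (w + c) @[w --> +oo] --> +oo.
Proof.
apply/cvgryPge => A; near=> w; rewrite -lerBlDr; near: w.
by apply: nbhs_pinfty_ge; rewrite num_real.
Unshelve. all: by end_near. Qed.

Lemma cvg_inv_pinfty : (w^-1 : R) @[w --> +oo] --> (0 : R).
Proof.
apply/gtr0_cvgV0; last exact: cvg_id.
by near=> w; near: w; apply: nbhs_pinfty_gt; rewrite num_real.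
Unshelve. all: by end_near. Qed.

Lemma cvg_lorentz_re (a c : R) : 0 < a ->
  ((a + (w + c) ^+ 2)^-1) @[w --> +oo] --> (0 : R).
Proof.
move=> a0.
suff H : ((a + w ^+ 2)^-1) @[w --> +oo] --> (0 : R).
  exact: (cvg_comp _ _ (cvg_shift_pinfty c) H).
apply: (@squeeze_cvgr _ _ _ _ (cst 0) (fun w => w^-1)); last 2 first.
- exact: cvg_cst.
- exact: cvg_inv_pinfty.
near=> w; have w1 : 1 <= w.
  by near: w; apply: nbhs_pinfty_ge; rewrite num_real.
have w0 : 0 < w by apply: lt_le_trans w1.
apply/andP; split; first by rewrite invr_ge0 addr_ge0 ?sqr_ge0 ?ltW.
rewrite lef_pV2 ?posrE//; last by rewrite ltr_wpDr ?sqr_ge0.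
by rewrite expr2 (le_trans (ler_peMl _ w1)) ?ltW// ltrDr.
Unshelve. all: by end_near. Qed.

Lemma cvg_lorentz_im (a c : R) : 0 < a ->
  ((w + c) / (a + (w + c) ^+ 2)) @[w --> +oo] --> (0 : R).
Proof.
move=> a0.
suff H : (w / (a + w ^+ 2)) @[w --> +oo] --> (0 : R).
  exact: (cvg_comp _ _ (cvg_shift_pinfty c) H).
apply: (@squeeze_cvgr _ _ _ _ (cst 0) (fun w => w^-1)); last 2 first.
- exact: cvg_cst.
- exact: cvg_inv_pinfty.
near=> w; have w0 : 0 < w.
  by near: w; apply: nbhs_pinfty_gt; rewrite num_real.
have d0 : 0 < a + w ^+ 2 by rewrite ltr_wpDr ?sqr_ge0.
apply/andP; split; first by rewrite divr_ge0 ?ltW.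
by rewrite ler_pdivrMr// mulrDr expr2 mulrA mulVf ?gt_eqF// mul1r lerDr mulr_ge0 ?invr_ge0 ?ltW.
Unshelve. all: by end_near. Qed.

Lemma ctends0_cpole l : Re l < 0 -> ctends0 (cpole l).
Proof.
move=> l0; have a0 : 0 < Re l ^+ 2 by rewrite exprn_even_gt0//= lt_eqF.
split.
- have -> : Re \o cpole l = (- Re l) \*: (fun w => (Re l ^+ 2 + (w - Im l) ^+ 2)^-1).
    by apply/funext => w; rewrite /= Re_cpole.
  apply: (@cvg_to_eq _ (- Re l *: 0)); last by rewrite scaler0.
  by apply: cvgZr; exact: cvg_lorentz_re.
- have -> : Im \o cpole l = - (fun w => (w - Im l) / (Re l ^+ 2 + (w - Im l) ^+ 2)).
    by apply/funext => w; rewrite /= Im_cpole.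
  apply: (@cvg_to_eq _ (- 0)); last by rewrite oppr0.
  by apply: cvgN; exact: cvg_lorentz_im.
Qed.

Lemma ctends0_cpoleN l : Re l < 0 -> ctends0 (fun w => cpole l (- w)).
Proof.
move=> l0; have a0 : 0 < Re l ^+ 2 by rewrite exprn_even_gt0//= lt_eqF.
have sq w : (- w - Im l) ^+ 2 = (w + Im l) ^+ 2 by rewrite -sqrrN; congr (_ ^+ 2); ring.
split.
- have -> : Re \o (fun w => cpole l (- w)) =
            (- Re l) \*: (fun w => (Re l ^+ 2 + (w + Im l) ^+ 2)^-1).
    by apply/funext => w; rewrite /= Re_cpole sq.
  apply: (@cvg_to_eq _ (- Re l *: 0)); last by rewrite scaler0.
  by apply: cvgZr; exact: cvg_lorentz_re.
- have -> : Im \o (fun w => cpole l (- w)) =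
            (fun w => (w + Im l) / (Re l ^+ 2 + (w + Im l) ^+ 2)).
    by apply/funext => w; rewrite /= Im_cpole sq -mulNr; congr (_ / _); ring.
  exact: cvg_lorentz_im.
Qed.

Lemma cvg_atan_shift (a c : R) : 0 < a -> atan ((w + c) / a) @[w --> +oo] --> (pi / 2 : R).
Proof.
move=> a0; apply: (cvg_comp (fun w => (w + c) / a) atan _ (@cvgy_atan R)).
apply/cvgryPge => A; near=> w.
rewrite ler_pdivlMr// -lerBlDr; near: w.
by apply: nbhs_pinfty_ge; rewrite num_real.
Unshelve. all: by end_near. Qed.

(** The arctangent contributes [pi / 2] at each end. The logarithm diverges at both ends and cancels
    only in the symmetric difference, which is why a principal value is taken. *)
Lemma pvint_cpole l : Re l < 0 -> pvint (cpole l) 1.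
Proof.
move=> l0; have a0 : 0 < Re l ^+ 2 by rewrite exprn_even_gt0//= lt_eqF.
have na : 0 < - Re l by rewrite oppr_gt0.
have sq w : (- w - Im l) ^+ 2 = (w + Im l) ^+ 2 by rewrite -sqrrN; congr (_ ^+ 2); ring.
split; first exact: cderive_continuous (cderive_cpole l0).
(* This is [- i log (i w - l)] in real coordinates: [i w - l] lies in the right half-plane, where
   the argument is an arctangent. *)
exists (fun w => Complex (atan ((w - Im l) / - Re l))
                        (- 2^-1 * ln (Re l ^+ 2 + (w - Im l) ^+ 2))).
  move=> w; have den := cpole_den w l0.
  have dm : is_derive w 1 (fun t => t - Im l) 1.
    exact: (is_derive_eq (is_deriveB (is_derive_id w 1) (is_derive_cst (Im l) w 1)) (subr0 1)).
  split.
  - have da : is_derive w 1 (fun t => (t - Im l) / - Re l) (- Re l)^-1.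
      have -> : (fun t => (t - Im l) / - Re l) = (- Re l)^-1 \*: (fun t => t - Im l).
        by apply/funext => t; rewrite /= mulrC.
      by apply: (is_derive_eq (is_deriveZ _ dm)); rewrite /GRing.scale/= mulr1.
    apply: (is_derive_eq (is_derive1_comp (is_derive1_atan _) da)).
    rewrite Re_cpole; field.
    by rewrite ?(lt_eqF l0) ?(gt_eqF na) ?(gt_eqF den).
  - have dn : is_derive w 1 (fun t => Re l ^+ 2 + (t - Im l) ^+ 2) (2 * (w - Im l)).
      apply: (is_derive_eq (is_deriveD (is_derive_cst (Re l ^+ 2) w 1) (is_deriveM dm dm))).
      by rewrite /GRing.scale/=; ring.
    have dl := @is_derive1_comp R (@ln R) (fun t => Re l ^+ 2 + (t - Im l) ^+ 2) _ _ _
      (is_derive1_ln den) dn.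
    apply: (is_derive_eq (is_deriveZ (- 2^-1) dl)).
    rewrite Im_cpole /GRing.scale/=; field.
    by rewrite gt_eqF.
rewrite mulr1; split.
- have -> : Re \o (fun w => Complex (atan ((w - Im l) / - Re l))
       (- 2^-1 * ln (Re l ^+ 2 + (w - Im l) ^+ 2)) -
     Complex (atan ((- w - Im l) / - Re l))
       (- 2^-1 * ln (Re l ^+ 2 + (- w - Im l) ^+ 2)) - to_C pi) =
     ((fun w => atan ((w - Im l) / - Re l)) + (fun w => atan ((w + Im l) / - Re l))) -
      cst (pi : R).
    apply/funext => w /=; congr (_ + _ - _).
    by rewrite -atanN -mulNr; congr (atan (_ / _)); ring.
  apply: (@cvg_to_eq _ (pi / 2 + pi / 2 - pi)); last by field.
  by apply: cvgB; [apply: cvgD; exact: cvg_atan_shift|exact: cvg_cst].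
(* The two logarithms combine into the logarithm of a quotient, and the quotient is 1 plus terms
   that tend to 0. *)
- pose D (c w : R) := Re l ^+ 2 + (w + c) ^+ 2.
  have D0 (c w : R) : 0 < D c w by rewrite ltr_wpDr ?sqr_ge0.
  have -> : Im \o (fun w => Complex (atan ((w - Im l) / - Re l))
       (- 2^-1 * ln (Re l ^+ 2 + (w - Im l) ^+ 2)) -
     Complex (atan ((- w - Im l) / - Re l))
       (- 2^-1 * ln (Re l ^+ 2 + (- w - Im l) ^+ 2)) - to_C pi) =
     - 2^-1 \*: (@ln R \o (cst 1 + (4 * (Im l) ^+ 2 \*: (fun w => (D (Im l) w)^-1) -
         4 * Im l \*: (fun w => (w + Im l) / D (Im l) w)))).
    apply/funext => w /=; rewrite subr0 sq -/(D (- Im l) w) -/(D (Im l) w).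
    rewrite -mulrBr -ln_div ?posrE//; congr (_ * ln _).
    transitivity (1 + (4 * Im l ^+ 2 * (D (Im l) w)^-1 -
      4 * Im l * ((w + Im l) / D (Im l) w))); last by [].
    have := D0 (Im l) w; rewrite /D => d0; field.
    by rewrite gt_eqF.
  apply: (@cvg_to_eq _ (- 2^-1 *: ln (1 + (4 * (Im l) ^+ 2 *: 0 - 4 * Im l *: 0)))); last first.
    by rewrite !scaler0 subrr addr0 ln1 scaler0.
  apply: cvgZr; apply: continuous_cvg.
    by apply: continuous_ln; rewrite !scaler0 subrr addr0.
  apply: cvgD; first exact: cvg_cst.
  by apply: cvgB; apply: cvgZr; [exact: cvg_lorentz_re|exact: cvg_lorentz_im].
Qed.

Lemma ctends0_cpoleX l k : Re l < 0 ->
  ctends0 (fun w => cpole l w ^+ k.+1) /\ ctends0 (fun w => cpole l (- w) ^+ k.+1).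
Proof.
move=> l0; elim: k => [|k [IH1 IH2]].
  by split; [exact: ctends0_cpole|exact: ctends0_cpoleN].
split.
- by have := ctends0M (ctends0_cpole l0) IH1; under eq_fun do rewrite -exprS.
- by have := ctends0M (ctends0_cpoleN l0) IH2; under eq_fun do rewrite -exprS.
Qed.

Lemma cderive_cpoleX l k : Re l < 0 ->
  cderive (fun w => cpole l w ^+ k.+1)
          (fun w => k.+1%:R * (Complex 0 (-1) * cpole l w ^+ k.+2)).
Proof.
move=> l0; elim: k => [|k IH].
  by have := cderive_cpole l0; under [X in _ -> cderive _ X]eq_fun do rewrite mul1r.
have := cderiveM (cderive_cpole l0) IH.
under eq_fun do rewrite -exprS.
under [X in cderive _ X -> _]eq_fun => w.
  have -> : Complex 0 (-1) * cpole l w ^+ 2 * cpole l w ^+ k.+1 +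
    cpole l w * (k.+1%:R * (Complex 0 (-1) * cpole l w ^+ k.+2)) =
    k.+2%:R * (Complex 0 (-1) * cpole l w ^+ k.+3).
    rewrite -(natr1 k.+1); move: (k.+1%:R) (Complex 0 (-1)) => m i; rewrite !exprS expr0.
    by move: (cpole l w ^+ k) (cpole l w) => p x; ring.
  over.
by [].
Qed.

(** A pole of order at least two has a power of [cpole] as antiderivative, and this power vanishes
    at both ends. *)
Lemma pvint_cpoleX l k : Re l < 0 -> pvint (fun w => cpole l w ^+ k.+2) 0.
Proof.
move=> l0; split.
  by apply: cderive_continuous; exact: cderive_cpoleX.
(* Differentiating [cpole l] produces a factor [- i], which the [i] in front cancels. *)
exists (fun w => (k.+1%:R^-1 * Complex 0 1) * cpole l w ^+ k.+1).
  have := cderiveZ (k.+1%:R^-1 * Complex 0 1) (cderive_cpoleX k l0).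
  under [X in cderive _ X -> _]eq_fun => w.
    have ii : Complex 0 1 * Complex 0 (-1) = 1 :> R[i].
      by apply/eqP; rewrite eq_complex /=; apply/andP; split; apply/eqP; ring.
    have -> : k.+1%:R^-1 * Complex 0 1 * (k.+1%:R * (Complex 0 (-1) * cpole l w ^+ k.+2)) =
      (k.+1%:R^-1 * k.+1%:R) * (Complex 0 1 * Complex 0 (-1)) * cpole l w ^+ k.+2.
      by ring.
    rewrite ii mulVf ?pnatr_eq0// !mul1r; over.
  by [].
have [t1 t2] := ctends0_cpoleX k l0.
have := ctends0D (ctends0Z (k.+1%:R^-1 * Complex 0 1) t1)
                 (ctends0Z (- (k.+1%:R^-1 * Complex 0 1)) t2).
by congr ctends0; apply/funext => w; ring.
Qed.

(* Two distinct poles turn the product into a difference of shorter products; otherwise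
   it is a power of a single pole, whose antiderivative vanishes at infinity. *)
Lemma pvint_prod_cpole (s : seq R[i]) : (forall l, l \in s -> Re l < 0) -> (0 < size s)%N ->
  pvint (fun w => \prod_(l <- s) cpole l w) (size s == 1)%:R.
Proof.
have [n] := ubnP (size s); elim: n s => // n IH [//|l [|m s]] sn sneg _.
  apply: eq_pvint (pvint_cpole (sneg l _)); last by rewrite inE.
  by move=> w; rewrite big_seq1.
have l0 : Re l < 0 by apply: sneg; rewrite inE eqxx.
have [/all_pred1P sE|/allPn[k ks /= kl]] := boolP (all (pred1 l) (m :: s)).
  rewrite sE; apply: eq_pvint (pvint_cpoleX (size s) l0) => w.
  rewrite big_cons big_nseq exprS; congr (_ * _).
  by rewrite iter_mulr_1.
have kt := perm_to_rem ks.
have k0 : Re k < 0 by apply: sneg; rewrite inE ks orbT.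
pose t := rem k (m :: s).
have st : size t = size s by rewrite size_rem.
have tneg x : x \in t -> Re x < 0.
  by move=> /mem_rem xs; apply: sneg; rewrite inE xs orbT.
have pl : pvint (fun w => \prod_(l <- l :: t) cpole l w) (size (l :: t) == 1)%:R.
  apply: IH => //=; first by rewrite st; move: sn => /=; rewrite !ltnS.
  by move=> x; rewrite inE => /predU1P[->//|]; exact: tneg.
have pk : pvint (fun w => \prod_(l <- k :: t) cpole l w) (size (k :: t) == 1)%:R.
  apply: IH => //=; first by rewrite st; move: sn => /=; rewrite !ltnS.
  by move=> x; rewrite inE => /predU1P[->//|]; exact: tneg.
(* Partial fractions: [cpole l * cpole k = (cpole l - cpole k) / (l - k)]. Both shorter products
   have the same length, hence the same value, and the difference has value 0. *)
have := pvintD (pvintZ (l - k)^-1 pl) (pvintZ (- (l - k)^-1) pk).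
rewrite mulNr addrN; apply: eq_pvint => w.
rewrite [RHS]big_cons (perm_big _ kt) /= -/t !big_cons /cpole.
have := cpole_neq0 w l0; have := cpole_neq0 w k0.
have : l - k != 0 by rewrite subr_eq0 eq_sym.
move: (\prod_(j <- t) ((Complex 0 w) - j)^-1) (Complex 0 w) => p z n1 n2 n3; field.
by rewrite n1 n2 n3.
Qed.

(* From (z - A) V = (z - l) V - (A - l) V, the resolvent applied to V is
   (z - l)^-1 (V + (z - A)^-1 (A - l) V); iterating over the eigenvalues terminates by
   the theorem of Cayley and Hamilton. *)
Lemma pvint_resolvent_aux n (A : 'M[R[i]]_n.+1) (s pre : seq R[i]) (V : 'M[R[i]]_n.+1) :
  (forall w, (Complex 0 w)%:M - A \in unitmx) ->
  (forall l, l \in s -> Re l < 0) -> (forall l, l \in pre -> Re l < 0) ->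
  horner_mx A (\prod_(l <- s) ('X - l%:P)) *m V = 0 ->
  pvint (fun w => (\prod_(l <- pre) cpole l w) * \tr (invmx ((Complex 0 w)%:M - A) *m V))
        (if pre is [::] then \tr V else 0).
Proof.
move=> uA; elim: s pre V => [|l s IH] pre V sneg pneg.
  rewrite big_nil rmorph1 mul1mx => ->.
  have -> : (if pre is [::] then \tr (0 : 'M[R[i]]_n.+1) else 0) = 0.
    by case: pre {pneg}; rewrite ?linear0.
  by apply: eq_pvint pvint0 => w; rewrite mulmx0 linear0 mulr0.
rewrite big_cons mulrC rmorphM/= -mulmxE -mulmxA rmorphB/= horner_mx_X horner_mx_C => AV.
have l0 : Re l < 0 by apply: sneg; rewrite inE eqxx.
have sneg' k : k \in s -> Re k < 0 by move=> ks; apply: sneg; rewrite inE ks orbT.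
have pneg' k : k \in l :: pre -> Re k < 0 by rewrite inE => /predU1P[->//|]; exact: pneg.
have H1 := pvintZ (\tr V) (pvint_prod_cpole pneg' isT).
have := pvintD H1 (IH (l :: pre) _ sneg' pneg' AV).
rewrite addr0.
(* The product over [l :: pre] is a simple pole exactly when [pre] is empty; only then does [\tr V]
   survive. *)
have -> : \tr V * (size (l :: pre) == 1)%:R = (if pre is [::] then \tr V else 0).
  by case: (pre) => [|? ?] /=; rewrite ?mulr1 ?mulr0.
apply: eq_pvint => w; rewrite !big_cons.
set z := Complex 0 w; set Ri := invmx _.
have zl := cpole_neq0 w l0; rewrite -/z in zl.
have -> : \tr (Ri *m V) = cpole l w * (\tr V + \tr (Ri *m ((A - l%:M) *m V))); last by ring.
have /(congr1 (fun M => \tr (Ri *m M))) : (z%:M - A) *m V = (z - l) *: V - (A - l%:M) *m V.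
  by rewrite !mulmxBl !mul_scalar_mx scalerBl opprB addrA subrK.
rewrite mulmxA mulVmx ?uA// mul1mx mulmxBr -scalemxAr linearB linearZ/= => ->.
rewrite /cpole -/z subrK mulrA mulVf ?mul1r//.
Qed.

Lemma hurwitz_resolvent_unit n (A : 'M[R]_n) w : hurwitz A ->
  (Complex 0 w)%:M - mxC A \in unitmx.
Proof.
move=> hA; rewrite -opprB -scaleN1r unitmxZ ?unitrN1// -row_free_unit -kermx_eq0.
apply/negPn/negP => ev; have := hA (Complex 0 w).
by rewrite -eigenvalue_root_char => /(_ ev) /=; rewrite ltxx.
Qed.

(** All eigenvalues are used as the list of [pvint_resolvent_aux]: the characteristic polynomial
    annihilates the matrix. The empty matrix is separate because polynomials in a matrix require a
    positive size. *)
Lemma pvint_resolvent n (A : 'M[R]_n) (V : 'M[R[i]]_n) : hurwitz A ->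
  pvint (fun w => \tr (invmx ((Complex 0 w)%:M - mxC A) *m V)) (\tr V).
Proof.
case: n A V => [|n] A V hA.
  by rewrite /mxtrace big_ord0; apply: eq_pvint pvint0 => w; rewrite big_ord0.
have [s sE] := closed_field_poly_normal (char_poly (mxC A)).
rewrite (monicP (char_poly_monic _)) scale1r in sE.
have sneg l : l \in s -> Re l < 0 by move=> ls; apply: hA; rewrite sE root_prod_XsubC.
have := @pvint_resolvent_aux n (mxC A) s [::] V (fun w => hurwitz_resolvent_unit w hA) sneg.
rewrite -sE Cayley_Hamilton mul0mx => /(_ _ erefl) H.
by apply: eq_pvint (H _) => // w; rewrite big_nil mul1r.
Qed.

(** * Sign of a principal value, and its comparison with the Lebesgue integral *)

Lemma pvint_Re f c : pvint f c -> exists2 h : R -> R,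
  (forall w, is_derive w 1 h (Re (f w))) & (h w - h (- w)) @[w --> +oo] --> pi * Re c.
Proof.
move=> [_ [F dF [Fc _]]]; exists (Re \o F); first by move=> w; have [] := dF w.
have -> : (fun w => (Re \o F) w - (Re \o F) (- w)) =
          (Re \o (fun w => F w - F (- w) - to_C pi * c)) + cst (pi * Re c).
  apply/funext => w.
  transitivity (Re (F w - F (- w) - to_C pi * c) + pi * Re c); last by [].
  by rewrite !(ReD, ReN, ReM) /= mul0r subr0 subrK.
apply: (@cvg_to_eq _ (0 + pi * Re c)); last by rewrite add0r.
by apply: cvgD; [exact: Fc|exact: cvg_cst].
Qed.

Lemma is_derive_ndecr (h h' : R -> R) : (forall w, is_derive w 1 h (h' w)) ->
  (forall w, 0 <= h' w) -> {homo h : x y / x <= y}.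
Proof.
move=> dh h0 x y xy; apply: (@ger0_derive1_ndecr _ h x y) => //.
- by move=> z _; rewrite derive1E; have [_ ->] := dh z.
- by apply: continuous_subspaceT; exact: is_derive_continuous dh.
Qed.

Lemma pvint_ge0 f c : pvint f c -> (forall w, 0 <= Re (f w)) -> 0 <= Re c.
Proof.
move=> /pvint_Re[h dh hc] f0; have hi := is_derive_ndecr dh f0.
have : 0 <= pi * Re c.
  apply: (cvgr_to_ge hc); near=> w; rewrite subr_ge0; apply: hi.
  by rewrite ge0_cp//; near: w; apply: nbhs_pinfty_ge; rewrite num_real.
by rewrite pmulr_rge0 ?pi_gt0.
Unshelve. all: by end_near. Qed.

Lemma pvint_gt0 f c : pvint f c -> (forall w, 0 < Re (f w)) -> 0 < Re c.
Proof.
move=> /pvint_Re[h dh hc] f0; have hi := is_derive_ndecr dh (fun w => ltW (f0 w)).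
have h1 : h (-1) < h 1.
  have lt11 : (-1 : R) < 1 by lra.
  apply: (@gtr0_derive1_incr _ h (-1) 1) => //.
  - by move=> z _; rewrite derive1E; have [_ ->] := dh z.
  - by apply: continuous_subspaceT; exact: is_derive_continuous dh.
(* Monotonicity bounds the symmetric differences below by the one at 1, so strictness survives the
   limit. *)
have : h 1 - h (-1) <= pi * Re c.
  apply: (cvgr_to_ge hc); near=> w.
  have w1 : 1 <= w by near: w; apply: nbhs_pinfty_ge; rewrite num_real.
  by apply: lerB; apply: hi => //; rewrite lerN2.
rewrite -subr_gt0 in h1; move=> /(lt_le_trans h1).
by rewrite pmulr_rgt0 ?pi_gt0.
Unshelve. all: by end_near. Qed.

(** The negative half-line is folded onto the positive one by [w -> - w]; the folded integrand has
    the antiderivative [h w - h (- w)], whose limit is the principal value. *)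
Lemma pvint_integral f c : pvint f c -> (forall w, 0 <= Re (f w)) ->
  (\int[lebesgue_measure]_(w in [set: R]) (Re (f w))%:E = (pi * Re c)%:E)%E.
Proof.
move=> pf f0; have [[cf _] _] := pf; have [h dh hc] := pvint_Re pf.
have cf0 : continuous (fun w => Re (f w)) by [].
have mf : measurable_fun [set: R] (Re \o f) by exact: continuous_measurable_fun.
have cfN : continuous (fun w => Re (f (- w))).
  move=> w; apply: (@continuous_comp _ _ _ (@GRing.opp R) (fun w => Re (f w))).
    exact: opp_continuous.
  exact: cf0.
rewrite -{1}setC0 -(set_itvoc0 0%R) setCitv/= ge0_integral_setU//=; first last.
- rewrite disj_set2E; apply/eqP; rewrite -subset0 => x []/= /[!in_itv]/=.
  by rewrite leNgt andbT => /negP.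
- by move=> x _; rewrite lee_fin.
- by apply/measurable_EFinP; rewrite -setCitvr setvU.
rewrite integral_itv_obnd_cbnd; last by apply/measurable_EFinP; exact: measurable_funTS.
rewrite -[X in `]-oo, X]]oppr0 ge0_integration_by_substitutionNy; last 2 first.
- exact: continuous_subspaceT.
- by move=> x _; exact: f0.
rewrite -ge0_integralD//=; last 4 first.
- by move=> x _; rewrite lee_fin; exact: f0.
- by apply/measurable_EFinP/measurable_funTS; exact: continuous_measurable_fun.
- by move=> x _; rewrite lee_fin; exact: f0.
- by apply/measurable_EFinP; exact: measurable_funTS.
pose h2 w := h w - h (- w).
have dh2 w : is_derive w 1 h2 (Re (f (- w)) + Re (f w)).
  have dN := @is_derive1_comp R h (@GRing.opp R) w _ _ (dh (- w)) (is_deriveNid w 1).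
  by apply: (is_derive_eq (is_deriveB (dh w) dN)); rewrite mulrN1 opprK addrC.
have ch2 := is_derive_continuous dh2.
under eq_integral do rewrite -EFinD.
rewrite (@ge0_continuous_FTC2y R (fun x => Re (f (- x)) + Re (f x)) h2 0 (pi * Re c)) //.
- by rewrite /h2 oppr0 subrr sube0.
- by move=> x _; rewrite addr_ge0.
- apply: continuous_subspaceT => x.
  by apply: cvgD; [exact: cfN|exact: cf0].
- by apply: cvg_at_right_filter; exact: ch2.
- by move=> x _; rewrite derive1E; have [_ ->] := dh2 x.
Qed.

(** * Lyapunov equations and the squared H2 norm *)

Lemma mxCE m n (M : 'M[R]_(m, n)) : mxC M = map_mx (real_complex R) M. Proof. by []. Qed.

Lemma mxCM m n p (M : 'M[R]_(m, n)) (N : 'M[R]_(n, p)) : mxC (M *m N) = mxC M *m mxC N.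
Proof. by rewrite !mxCE map_mxM. Qed.

Lemma mxCD m n (M N : 'M[R]_(m, n)) : mxC (M + N) = mxC M + mxC N.
Proof. by rewrite !mxCE map_mxD. Qed.

Lemma mxCN m n (M : 'M[R]_(m, n)) : mxC (- M) = - mxC M.
Proof. by rewrite !mxCE map_mxN. Qed.

Lemma ctrmxM m n p (M : 'M[R[i]]_(m, n)) (N : 'M[R[i]]_(n, p)) :
  ctrmx (M *m N) = ctrmx N *m ctrmx M.
Proof. by rewrite /ctrmx map_mxM trmx_mul. Qed.

Lemma ctrmxK m n (M : 'M[R[i]]_(m, n)) : ctrmx (ctrmx M) = M.
Proof. by apply/matrixP => i j; rewrite !mxE conjcK. Qed.

Lemma ctrmxC m n (M : 'M[R]_(m, n)) : ctrmx (mxC M) = mxC M^T.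
Proof. by apply/matrixP => i j; rewrite !mxE /to_C /= oppr0. Qed.

Lemma Re_tr_ctrmx n (M : 'M[R[i]]_n) : Re (\tr (ctrmx M)) = Re (\tr M).
Proof.
rewrite /ctrmx mxtrace_tr /mxtrace; under eq_bigr do rewrite mxE.
by rewrite -rmorph_sum; case: (\sum_i _).
Qed.

Lemma tr_mxC n (M : 'M[R]_n) : \tr (mxC M) = to_C (\tr M).
Proof. by rewrite mxCE trace_map_mx. Qed.

(** With [Z = i w - A], the scalar parts cancel in [Z X + X Z^*], which leaves [M]. Multiplying by
    the inverses of [Z] and [Z^*] gives the identity. *)
Lemma resolvent_lyapunov n (A X M : 'M[R]_n) w : hurwitz A ->
  A *m X + X *m A^T = - M ->
  let Ri := invmx ((Complex 0 w)%:M - mxC A) in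
  Ri *m mxC M *m ctrmx Ri = Ri *m mxC X + mxC X *m ctrmx Ri.
Proof.
move=> hA AX; have := hurwitz_resolvent_unit w hA.
set Z := _%:M - mxC A => uZ Ri.
have ZR : Ri *m Z = 1%:M by rewrite mulVmx.
have cZR : ctrmx Z *m ctrmx Ri = 1%:M.
  rewrite -ctrmxM ZR; apply/matrixP => i j; rewrite !mxE eq_sym.
  exact: conjc_nat.
have cZ : ctrmx Z = (Complex 0 (- w))%:M - mxC A^T.
  apply/matrixP => i j; rewrite !mxE eq_sym /to_C; apply/eqP; rewrite eq_complex.
  by case: (i == j) => /=; apply/andP; split; apply/eqP => /=; ring.
have -> : mxC M = Z *m mxC X + mxC X *m ctrmx Z.
  rewrite -[M]opprK -AX mxCN mxCD !mxCM cZ mulmxBl mulmxBr mul_scalar_mx mul_mx_scalar.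
  have -> : Complex 0 (- w) = - Complex 0 w :> R[i].
    by apply/eqP; rewrite eq_complex /= oppr0 !eqxx.
  by rewrite scaleNr addrACA subrr add0r opprD.
rewrite mulmxDr mulmxDl mulmxA ZR mul1mx mulmxA -[_ *m ctrmx Z *m _]mulmxA cZR mulmx1.
by rewrite addrC.
Qed.

(** The free weight [Y] lets one identity serve uniqueness ([M = 0]), positivity ([Y = v v^T]) and
    the H2 norm ([Y = C^T C]). In real part, the second term of [resolvent_lyapunov] equals the
    first one with [X^T] and [Y^T], and each contributes [\tr (X *m Y)]. *)
Lemma lyapunov_pvint n (A X M Y : 'M[R]_n) : hurwitz A ->
  A *m X + X *m A^T = - M ->
  exists2 f, pvint f (to_C (2 * \tr (X *m Y))) &
    forall w, let Ri := invmx ((Complex 0 w)%:M - mxC A) in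
      Re (f w) = Re (\tr (Ri *m mxC M *m ctrmx Ri *m mxC Y)).
Proof.
move=> hA AX.
have := pvintD (pvint_resolvent (mxC (X *m Y)) hA) (pvint_resolvent (mxC (X^T *m Y^T)) hA).
have tE : \tr (X^T *m Y^T) = \tr (X *m Y) by rewrite -trmx_mul mxtrace_tr mxtrace_mulC.
rewrite !tr_mxC tE => H.
eexists; last first.
  move=> w Ri; rewrite (resolvent_lyapunov w hA AX) -/Ri mulmxDl linearD/= ReD.
  rewrite -[X in _ + X]Re_tr_ctrmx !ctrmxM ctrmxK !ctrmxC (mxtrace_mulC (mxC Y^T)) -!mulmxA -!mxCM.
  rewrite -ReD /Ri; reflexivity.
have -> : to_C (2 * \tr (X *m Y)) = to_C (\tr (X *m Y)) + to_C (\tr (X *m Y)).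
  by apply/eqP; rewrite eq_complex /= addr0 eqxx andbT; apply/eqP; ring.
exact: H.
Qed.

Lemma mxtrace11 (S : comNzRingType) (M : 'M[S]_1) : \tr M = M 0 0.
Proof. by rewrite /mxtrace big_ord1. Qed.

(** The cross terms are real numbers times [i] and drop out of the real part. *)
Lemma Re_hermitian_form n (M : 'M[R]_n) (u : 'cV[R[i]]_n) :
  let a := map_mx Re u in let b := map_mx Im u in
  Re (\tr (ctrmx u *m mxC M *m u)) = (a^T *m M *m a) 0 0 + (b^T *m M *m b) 0 0.
Proof.
move=> a b.
have uE : u = mxC a + Complex 0 1 *: mxC b.
  apply/matrixP => i j; rewrite !mxE /to_C; case: (u i j) => x y.
  by apply/eqP; rewrite eq_complex; apply/andP; split; apply/eqP => /=; ring.
have cuE : ctrmx u = mxC a^T - Complex 0 1 *: mxC b^T.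
  apply/matrixP => i j; rewrite !mxE /to_C; case: (u j i) => x y.
  by apply/eqP; rewrite eq_complex; apply/andP; split; apply/eqP => /=; ring.
rewrite cuE {1}uE mulmxDr !mulmxBl -!scalemxAl -!scalemxAr -!mxCM.
move: (a^T *m M *m a) (b^T *m M *m a) (a^T *m M *m b) (b^T *m M *m b) => P Q S T.
rewrite raddfD !raddfB /= !mxtraceZ !tr_mxC !mxtrace11 /=.
by move: (P 0 0) (Q 0 0) (S 0 0) (T 0 0) => p q s t; ring.
Qed.

Lemma Re_hermitian_gt0 n (M : 'M[R]_n) (u : 'cV[R[i]]_n) :
  (forall x : 'cV[R]_n, x != 0 -> 0 < (x^T *m M *m x) 0 0) -> u != 0 ->
  0 < Re (\tr (ctrmx u *m mxC M *m u)).
Proof.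
move=> Mp u0; rewrite Re_hermitian_form.
have Mge (x : 'cV[R]_n) : 0 <= (x^T *m M *m x) 0 0.
  by have [->|/Mp/ltW//] := eqVneq x 0; rewrite mulmx0 mxE.
have [a0|a0] := eqVneq (map_mx Re u) 0; last first.
  by apply: ltr_pwDl; [exact: Mp|exact: Mge].
apply: ltr_wpDl; first exact: Mge.
apply: Mp; apply: contra u0 => /eqP b0; apply/eqP/matrixP => i j.
move/matrixP: a0 => /(_ i j); move/matrixP: b0 => /(_ i j); rewrite !mxE.
by case: (u i j) => x y /= -> ->.
Qed.

Lemma tr_mul_col n (M : 'M[R]_n) (v : 'cV[R]_n) : \tr (M *m (v *m v^T)) = (v^T *m M *m v) 0 0.
Proof. by rewrite mulmxA mxtrace_mulC -mxtrace11 mulmxA. Qed.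

Lemma tr_mulmxT m n (M : 'M[R]_(m, n)) : \tr (M *m M^T) = \sum_i \sum_j M i j ^+ 2.
Proof.
by apply: eq_bigr => i _; rewrite mxE; apply: eq_bigr => j _; rewrite mxE expr2.
Qed.

Lemma tr_mulmxT_ge0 m n (M : 'M[R]_(m, n)) : 0 <= \tr (M *m M^T).
Proof. by rewrite tr_mulmxT; do 2!apply: sumr_ge0 => ? _; exact: sqr_ge0. Qed.

Lemma tr_mulmxT_eq0 m n (M : 'M[R]_(m, n)) : \tr (M *m M^T) = 0 -> M = 0.
Proof.
rewrite tr_mulmxT => /eqP; rewrite psumr_eq0; last first.
  by move=> i _; apply: sumr_ge0 => j _; exact: sqr_ge0.
move=> /allP H; apply/matrixP => i j; rewrite mxE.
have := H i (mem_index_enum _); rewrite /= psumr_eq0; last by move=> k _; exact: sqr_ge0.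
by move=> /allP /(_ j (mem_index_enum _)) /=; rewrite sqrf_eq0 => /eqP.
Qed.

(** For [M = 0] the integrand vanishes, and the weight [- X^T] turns nonnegativity of its principal
    value into [\tr (X *m X^T) <= 0]. *)
Lemma lyapunov_inj n (A X : 'M[R]_n) : hurwitz A -> A *m X + X *m A^T = 0 -> X = 0.
Proof.
move=> hA AX; have AX0 : A *m X + X *m A^T = - 0 by rewrite oppr0.
apply: tr_mulmxT_eq0; apply/eqP; rewrite eq_le tr_mulmxT_ge0 andbT.
have [f pf fE] := lyapunov_pvint (- X^T) hA AX0.
have : 0 <= complex.Re (to_C (2 * \tr (X *m - X^T))).
  apply: (pvint_ge0 pf) => w; rewrite fE.
  have -> : mxC (0 : 'M[R]_n) = 0 by rewrite mxCE map_mx0.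
  by rewrite mulmx0 !mul0mx linear0.
by rewrite mulmxN linearN /= mulrN oppr_ge0 pmulr_rle0.
Qed.

(** The Lyapunov operator is an injective endomorphism of a finite-dimensional space; [L] is its
    matrix on vectorized arguments. *)
Lemma lyapunov_exists n (A M : 'M[R]_n) : hurwitz A -> exists X, A *m X + X *m A^T = - M.
Proof.
move=> hA; pose L := lin_mulmx A + lin_mulmxr A^T.
have LE X : mxvec X *m L = mxvec (A *m X + X *m A^T).
  by rewrite mulmxDr !mul_vec_lin /= linearD.
have uL : L \in unitmx.
  rewrite -row_free_unit; apply: inj_row_free => v.
  rewrite -[v]vec_mxK LE => /(congr1 vec_mx); rewrite mxvecK linear0.
  by move=> /(lyapunov_inj hA) ->; rewrite linear0.
exists (vec_mx (mxvec (- M) *m invmx L)).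
by apply: (can_inj mxvecK); rewrite -LE vec_mxK mulmxKV.
Qed.

(** Symmetry follows from uniqueness, since [X - X^T] solves the homogeneous equation. For
    positivity, the integrand is the form of [M] at [R^* v], nonzero because the resolvent is
    invertible. *)
Lemma lyapunov_pd n (A X M : 'M[R]_n) : hurwitz A -> pd M ->
  A *m X + X *m A^T = - M -> pd X.
Proof.
move=> hA [Ms Mp] AX; split.
  apply/eqP; rewrite -subr_eq0; apply/eqP; apply: (lyapunov_inj hA).
  rewrite mulmxBr mulmxBl addrACA -opprD AX.
  have -> : A *m X^T + X^T *m A^T = (A *m X + X *m A^T)^T.
    by rewrite linearD /= !trmx_mul trmxK addrC.
  by rewrite AX linearN /= Ms subrr.
move=> v v0; have [f pf fE] := lyapunov_pvint (v *m v^T) hA AX.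
have : 0 < complex.Re (to_C (2 * \tr (X *m (v *m v^T)))); last first.
  by rewrite /= pmulr_rgt0// tr_mul_col.
apply: (pvint_gt0 pf) => w; rewrite fE.
set Ri := invmx _; pose u := ctrmx Ri *m mxC v.
have uRi : Ri \in unitmx by rewrite unitmx_inv hurwitz_resolvent_unit.
have cRiU : ctrmx Ri \in unitmx by rewrite unitmx_tr map_unitmx.
rewrite mxCM mulmxA mxtrace_mulC !mulmxA -ctrmxC -{1}(ctrmxK Ri) -ctrmxM -mulmxA -/u.
apply: Re_hermitian_gt0 => //; apply: contra v0 => /eqP uz; apply/eqP.
have : mxC v = 0 by rewrite -(mulKmx cRiU (mxC v)) -/u uz mulmx0.
by move/matrixP => vz; apply/matrixP => i j; move: (vz i j); rewrite !mxE => -[].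
Qed.

(** At a left eigenvector [v] for [z], the form of [A X + X A^T] is [2 Re z] times that of [X]. *)
Lemma lyapunov_hurwitz n (A X : 'M[R]_n) : pd X -> pd (- (A *m X + X *m A^T)) -> hurwitz A.
Proof.
move=> [_ Xp] [_ Np] z; rewrite -eigenvalue_root_char => /eigenvalueP[v vA v0].
have cv0 : ctrmx v != 0.
  by apply: contra v0 => /eqP cv; rewrite -(ctrmxK v) cv /ctrmx map_mx0 trmx0.
have pos (M : 'M[R]_n) : (forall x : 'cV[R]_n, x != 0 -> 0 < (x^T *m M *m x) 0 0) ->
    0 < complex.Re (\tr (v *m mxC M *m ctrmx v)).
  by move=> Mp; rewrite -{1}(ctrmxK v); exact: Re_hermitian_gt0.
have X0 := pos X Xp; have := pos _ Np.
have vAc : mxC A^T *m ctrmx v = conjc z *: ctrmx v.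
  by rewrite -ctrmxC -ctrmxM vA; apply/matrixP => i j; rewrite !mxE rmorphM.
rewrite mxCN mxCD !mxCM mulmxN mulNmx mulmxDr mulmxDl !mulmxA vA -!mulmxA vAc.
rewrite -!scalemxAl -!scalemxAr -scalerDl !linearN linearZ /=.
move: X0; rewrite !mulmxA; case: (\tr _) => x y; case: z {vA vAc} => p q /= x0.
rewrite subrr mul0r subr0 -mulNr (pmulr_lgt0 _ x0) => pp.
by lra.
Qed.

Lemma Re_tr_ctrmx_mul_ge0 m n (T : 'M[R[i]]_(m, n)) : 0 <= complex.Re (\tr (ctrmx T *m T)).
Proof.
rewrite /mxtrace raddf_sum /=; apply: sumr_ge0 => i _; rewrite mxE raddf_sum /=.
apply: sumr_ge0 => j _; rewrite !mxE; case: (T j i) => x y /=.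
by rewrite mulNr opprK -!expr2 addr_ge0 ?sqr_ge0.
Qed.

Lemma h2_integral n p q (A : 'M[R]_n) (B : 'M[R]_(n, p)) (C : 'M[R]_(q, n)) (X : 'M[R]_n) :
  hurwitz A -> A *m X + X *m A^T = - (B *m B^T) ->
  let T w := mxC C *m invmx ((Complex 0 w)%:M - mxC A) *m mxC B in
  (\int[lebesgue_measure]_(w in [set: R]) (Re (\tr (ctrmx (T w) *m T w)))%:E =
   (2 * pi * \tr (C *m X *m C^T))%:E)%E.
Proof.
move=> hA AX T; have [f pf fE] := lyapunov_pvint (C^T *m C) hA AX.
have TE w : Re (\tr (ctrmx (T w) *m T w)) = Re (f w).
  rewrite fE mxtrace_mulC /T !ctrmxM !ctrmxC !mxCM !mulmxA.
  by congr (Re _); rewrite [RHS]mxtrace_mulC !mulmxA.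
under eq_integral do rewrite TE.
rewrite (pvint_integral pf); last by move=> w; rewrite -TE; exact: Re_tr_ctrmx_mul_ge0.
by congr (_%:E); rewrite /= mulmxA mxtrace_mulC mulmxA; ring.
Qed.

End PrincipalValue.

(** * Positive definite matrices *)

Section PositiveDefinite.
Variable R : realType.

Lemma pd_ge0 n (M : 'M[R]_n) (x : 'cV[R]_n) : pd M -> 0 <= (x^T *m M *m x) 0 0.
Proof. by move=> [_ Mp]; have [->|/Mp/ltW//] := eqVneq x 0; rewrite mulmx0 mxE. Qed.

Lemma pd_unit n (M : 'M[R]_n) : pd M -> M \in unitmx.
Proof.
move=> [Ms Mp]; rewrite -row_free_unit; apply: inj_row_free => v vM.
apply/eqP/negPn/negP => v0; have vT0 : v^T != 0 by rewrite trmx_eq0.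
by have := Mp _ vT0; rewrite trmxK vM mul0mx mxE ltxx.
Qed.

Lemma pd_congr n (M T : 'M[R]_n) : pd M -> T \in unitmx -> pd (T *m M *m T^T).
Proof.
move=> [Ms Mp] uT; split; first by rewrite !trmx_mul trmxK Ms mulmxA.
move=> x x0; have := Mp (T^T *m x); rewrite trmx_mul trmxK !mulmxA; apply.
apply: contra x0 => /eqP Tx.
by rewrite -(mulKmx (_ : T^T \in unitmx) x) ?unitmx_tr// Tx mulmx0.
Qed.

Lemma pd_inv n (M : 'M[R]_n) : pd M -> pd (invmx M).
Proof.
move=> pM; have uM := pd_unit pM; have [Ms _] := pM.
have uiM : invmx M \in unitmx by rewrite unitmx_inv.
by have := pd_congr pM uiM; rewrite mulVmx// mul1mx trmx_inv Ms.
Qed.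

Lemma pdD n (M N : 'M[R]_n) : pd M -> pd N -> pd (M + N).
Proof.
move=> [Ms Mp] [Ns Np]; split; first by rewrite linearD /= Ms Ns.
by move=> x x0; rewrite mulmxDr mulmxDl mxE addr_gt0 ?Mp ?Np.
Qed.

Lemma pd_psdD n (M N : 'M[R]_n) : pd M -> psd N -> pd (M + N).
Proof.
move=> [Ms Mp] [Ns Np]; split; first by rewrite linearD /= Ms Ns.
by move=> x x0; rewrite mulmxDr mulmxDl mxE ltr_pwDl ?Mp ?Np.
Qed.

Lemma pdZ n (M : 'M[R]_n) c : 0 < c -> pd M -> pd (c *: M).
Proof.
move=> c0 [Ms Mp]; split; first by rewrite linearZ /= Ms.
by move=> x x0; rewrite -scalemxAr -scalemxAl mxE mulr_gt0 ?Mp.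
Qed.

Lemma pd1 n : pd (1%:M : 'M[R]_n).
Proof.
split; first by rewrite trmx1.
move=> x x0; rewrite mulmx1 -mxtrace11 -{2}(trmxK x) lt_neqAle tr_mulmxT_ge0 andbT eq_sym.
by apply: contra x0 => /eqP/tr_mulmxT_eq0 xT; rewrite -(trmxK x) xT trmx0.
Qed.

Lemma psd_mulT m n (M : 'M[R]_(m, n)) : psd (M *m M^T).
Proof.
split; first by rewrite trmx_mul trmxK.
by move=> x; rewrite mulmxA -mulmxA -mxtrace11 -{2}(trmxK x) -trmx_mul tr_mulmxT_ge0.
Qed.

Lemma psdZ n (M : 'M[R]_n) c : 0 <= c -> psd M -> psd (c *: M).
Proof.
move=> c0 [Ms Mp]; split; first by rewrite linearZ /= Ms.
by move=> x; rewrite -scalemxAr -scalemxAl mxE mulr_ge0.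
Qed.

Lemma pd_convex n (M N : 'M[R]_n) t : 0 <= t <= 1 -> pd M -> pd N -> pd ((1 - t) *: M + t *: N).
Proof.
move=> /andP[t0 t1] pM pN; have [->|tn0] := eqVneq t 0.
  by rewrite subr0 scale1r scale0r addr0.
have [->|tn1] := eqVneq t 1; first by rewrite subrr scale0r scale1r add0r.
by apply: pdD; apply: pdZ => //; rewrite ?subr_gt0 lt_neqAle ?tn1 // eq_sym tn0.
Qed.

Lemma tr_pd_ge0 m n (D : 'M[R]_n) (C : 'M[R]_(m, n)) : pd D -> 0 <= \tr (C *m D *m C^T).
Proof.
move=> pD; apply: sumr_ge0 => i _.
have -> : (C *m D *m C^T) i i = ((row i C)^T^T *m D *m (row i C)^T) 0 0.
  by rewrite trmxK -row_mul [LHS]mxE [RHS]mxE; apply: eq_bigr => j _; rewrite !mxE.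
exact: pd_ge0.
Qed.

Lemma mulmx_delta m n (M : 'M[R]_(m, n)) i k : (M *m (delta_mx i 0 : 'cV[R]_n)) k 0 = M k i.
Proof.
rewrite mxE (bigD1 i)//= big1; last by move=> j ji; rewrite !mxE (negbTE ji) mulr0.
by rewrite !mxE !eqxx mulr1 addr0.
Qed.

(** An explicit constant replaces compactness of the unit sphere: each squared coordinate is bounded
    by a diagonal entry of [M^-1] times the form, and the bounds are added. *)
Lemma pd_coercive n (M : 'M[R]_n) : pd M -> exists2 c : R, 0 < c &
  forall x : 'cV[R]_n, c * \tr (x^T *m x) <= (x^T *m M *m x) 0 0.
Proof.
move=> pM; have pV := pd_inv pM; have uM := pd_unit pM; have [Ms _] := pM.
have [Vs Vp] := pV.
pose d i := (invmx M) i i.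
have dE i : d i = ((delta_mx i 0 : 'cV[R]_n)^T *m invmx M *m (delta_mx i 0 : 'cV[R]_n)) 0 0.
  by rewrite mulmx_delta trmx_delta -rowE mxE.
have d0 i : 0 < d i.
  rewrite dE; apply: Vp; apply/eqP => /matrixP /(_ i 0).
  by rewrite !mxE !eqxx => /eqP; rewrite oner_eq0.
(* Cauchy-Schwarz for the form [M], applied to [x] and [M^-1 e_i]. *)
have dx i (x : 'cV[R]_n) : x i 0 ^+ 2 <= d i * (x^T *m M *m x) 0 0.
  pose u := invmx M *m (delta_mx i 0 : 'cV[R]_n).
  (* The minimizer over [s] of the form at [x - s *: u]. *)
  pose s := x i 0 / d i.
  have := pd_ge0 (x - s *: u) pM.
  have Mu : M *m u = delta_mx i 0 by rewrite mulKVmx.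
  have uM' : u^T *m M = (delta_mx i 0 : 'cV[R]_n)^T by rewrite -[in RHS]Mu [RHS]trmx_mul Ms.
  have xu : (x^T *m M *m u) 0 0 = x i 0 by rewrite -mulmxA Mu mulmx_delta mxE.
  have ux : (u^T *m M *m x) 0 0 = x i 0 by rewrite uM' trmx_delta -rowE !mxE.
  have uu : (u^T *m M *m u) 0 0 = d i by rewrite uM' dE mulmxA.
  have -> : (x - s *: u)^T = x^T - s *: u^T by rewrite linearB linearZ.
  rewrite !mulmxBl !mulmxBr -!scalemxAl -!scalemxAr.
  move: xu ux uu; move: (x^T *m M *m x) (x^T *m M *m u) (u^T *m M *m x) (u^T *m M *m u).
  move=> P Q S T xu ux uu; rewrite !mxE xu ux uu => H.
  rewrite -ler_pdivrMl// -subr_ge0; apply: le_trans H _.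
  rewrite le_eqVlt; apply/orP; left; apply/eqP; rewrite /s; field.
  by rewrite gt_eqF.
(* The trace of [M^-1] would suffice in positive dimension; the added 1 keeps [D] positive in
   dimension 0. *)
pose D := 1 + \sum_i d i.
have D0 : 0 < D by rewrite ltr_pwDl ?ltr01// sumr_ge0// => i _; exact: ltW.
exists D^-1; first by rewrite invr_gt0.
move=> x; rewrite ler_pdivrMl// mxtrace11 mxE.
rewrite (eq_bigr (fun i => x i 0 ^+ 2)); last by move=> i _; rewrite mxE expr2.
rewrite mulrDl mul1r mulr_suml; apply: ler_wpDl; first exact: pd_ge0.
by apply: ler_sum.
Qed.

(** The form of [E] is at least [- b] times the squared norm and that of [M] at least [c] times it,
    so [c / b] is an admissible radius. *)
Lemma pd_open n (M E : 'M[R]_n) : pd M -> E^T = E -> exists2 d : R, 0 < d &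
  forall e, 0 <= e < d -> pd (M + e *: E).
Proof.
move=> pM Es; have [c c0 cM] := pd_coercive pM; have [Ms Mp] := pM.
pose b := 1 + \sum_i \sum_j `|E i j|.
have b0 : 0 < b by rewrite ltr_pwDl ?ltr01//; do 2!apply: sumr_ge0 => ? _.
have bE (x : 'cV[R]_n) : - (b * \tr (x^T *m x)) <= (x^T *m E *m x) 0 0.
  rewrite lerNl; apply: le_trans (ler_norm _) _; rewrite normrN mxE.
  rewrite (eq_bigr (fun j => \sum_i x i 0 * E i j * x j 0)); last first.
    by move=> j _; rewrite mxE mulr_suml; apply: eq_bigr => i _; rewrite mxE.
  rewrite exchange_big /= mulrDl mul1r; apply: ler_wpDl.
    by rewrite -{2}(trmxK x) tr_mulmxT_ge0.
  rewrite mulr_suml; apply: le_trans (ler_norm_sum _ _ _) _; apply: ler_sum => i _.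
  rewrite mulr_suml; apply: le_trans (ler_norm_sum _ _ _) _; apply: ler_sum => j _.
  have xk k : x k 0 ^+ 2 <= \tr (x^T *m x).
    rewrite mxtrace11 mxE (bigD1 k)//= mxE -expr2 lerDl sumr_ge0// => l _.
    by rewrite mxE -expr2 sqr_ge0.
  rewrite !normrM mulrAC mulrC ler_wpM2l//.
  have := xk i; have := xk j; have := sqr_ge0 (`|x i 0| - `|x j 0|).
  rewrite -(real_normK (num_real (x i 0))) -(real_normK (num_real (x j 0))).
  by move: (`|x i 0|) (`|x j 0|) (\tr _) => p q t; nra.
exists (c / b); first exact: divr_gt0.
move=> e /andP[e0 eb]; split; first by rewrite linearD linearZ /= Ms Es.
move=> x x0; rewrite mulmxDr mulmxDl -scalemxAr -scalemxAl.
move: (cM x) (bE x); have : 0 < \tr (x^T *m x).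
  by have [_ /(_ x x0)] := pd1 n; rewrite mulmx1 mxtrace11.
rewrite ltr_pdivlMr// in eb.
have -> (P Q : 'M[R]_1) : (P + e *: Q) 0 0 = P 0 0 + e * Q 0 0 by rewrite !mxE.
move: (\tr _) ((x^T *m M *m x) 0 0) ((x^T *m E *m x) 0 0) => t p q t0 H1 H2.
have : e * - (b * t) <= e * q by rewrite ler_wpM2l.
have : e * b * t < c * t by rewrite ltr_pM2r.
by lra.
Qed.

(** Otherwise the points [d / 2, d / 3, ...], as many as the size of [p], would all be roots. *)
Lemma horner_neq0_small (p : {poly R}) (d : R) : p != 0 -> 0 < d ->
  exists2 e, 0 < e < d & p.[e] != 0.
Proof.
move=> p0 d0; apply: contrapT => H.
pose s := [seq d / k.+2%:R | k <- iota 0 (size p)].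
have : (size s < size p)%N.
  apply: max_poly_roots p0 _ _.
    apply/allP => x /mapP[k _ ->]; apply/negPn/negP => rx; apply: H.
    exists (d / k.+2%:R) => //; rewrite divr_gt0//= ltr_pdivrMr ?ltr0n//.
    by rewrite ltr_pMr// ltr1n.
  rewrite map_inj_uniq ?iota_uniq// => i j /(mulfI (lt0r_neq0 d0))/invr_inj/eqP.
  by rewrite eqr_nat => /eqP[].
by rewrite size_map size_iota ltnn.
Qed.

Lemma unit_perturb n (M : 'M[R]_n) (d : R) : 0 < d ->
  exists2 e, 0 < e < d & M + e%:M \in unitmx.
Proof.
move=> d0; have p0 : char_poly (- M) != 0 by rewrite monic_neq0// char_poly_monic.
have [e ed pe] := horner_neq0_small p0 d0; exists e => //.
have -> : M + e%:M = (-1) *: (- M - e%:M) by rewrite scaleN1r opprB opprK addrC.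
rewrite unitmxZ ?unitrN1// -row_free_unit -kermx_eq0; apply: contraNT pe => ev.
by rewrite -[_ == 0]/(root _ e) -eigenvalue_root_char.
Qed.

End PositiveDefinite.

(** * Paths of matrices *)

Section MatrixPaths.
Variable R : realType.

Definition mcont (T : topologicalType) m n (p : T -> 'M[R]_(m, n)) :=
  forall i j, continuous (fun t => p t i j).

Lemma mcontP (T : topologicalType) m n (p : T -> 'M[R]_(m, n)) : mcont p <-> continuous p.
Proof.
split=> [cp t A [P Pn PA]|cp i j t]; last first.
  exact: (continuous_comp (cp t) (@coord_continuous R m n i j (p t))).
have : \forall x \near t, forall ij : 'I_m * 'I_n, P ij.1 ij.2 (p x ij.1 ij.2).
  by apply: filter_forall => -[i j]; exact: (cp i j t _ (Pn i j)).
by apply: filterS => x Px; apply: PA => i j; exact: (Px (i, j)).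
Qed.

Section Operations.
Variable T : topologicalType.

Lemma contD (f g : T -> R) : continuous f -> continuous g -> continuous (fun t => f t + g t).
Proof. by move=> cf cg t; exact: cvgD (cf t) (cg t). Qed.

Lemma contB (f g : T -> R) : continuous f -> continuous g -> continuous (fun t => f t - g t).
Proof. by move=> cf cg t; exact: cvgB (cf t) (cg t). Qed.

Lemma contM (f g : T -> R) : continuous f -> continuous g -> continuous (fun t => f t * g t).
Proof. by move=> cf cg t; exact: cvgM (cf t) (cg t). Qed.

Lemma contV (f : T -> R) : (forall t, f t != 0) -> continuous f ->
  continuous (fun t => (f t)^-1).
Proof. by move=> f0 cf t; exact: cvgV (f0 t) (cf t). Qed.

Lemma cont_cst (a : R) : continuous (fun _ : T => a).
Proof. by move=> t; exact: cvg_cst. Qed.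

Lemma mcont_cst m n (A : 'M[R]_(m, n)) : mcont (fun _ : T => A).
Proof. by move=> i j; exact: cst_continuous. Qed.

Lemma mcontD m n (p q : T -> 'M[R]_(m, n)) : mcont p -> mcont q -> mcont (fun t => p t + q t).
Proof.
move=> cp cq i j; under eq_fun do rewrite mxE.
by apply: contD; [exact: cp|exact: cq].
Qed.

Lemma mcontN m n (p : T -> 'M[R]_(m, n)) : mcont p -> mcont (fun t => - p t).
Proof.
move=> cp i j; under eq_fun do rewrite mxE.
by move=> t; apply: continuousN; exact: cp.
Qed.

Lemma mcontZ m n (c : T -> R) (p : T -> 'M[R]_(m, n)) :
  continuous c -> mcont p -> mcont (fun t => c t *: p t).
Proof.
move=> cc cp i j; under eq_fun do rewrite mxE.
by apply: contM; [exact: cc|exact: cp].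
Qed.

Lemma continuous_sumR (I : Type) (r : seq I) (F : I -> T -> R) :
  (forall i, continuous (F i)) -> continuous (fun t => \sum_(i <- r) F i t).
Proof.
move=> cF; elim: r => [|i r IH].
  by under eq_fun do rewrite big_nil; exact: cst_continuous.
under eq_fun do rewrite big_cons.
by apply: contD; [exact: cF|exact: IH].
Qed.

Lemma continuous_prodR (I : Type) (r : seq I) (F : I -> T -> R) :
  (forall i, continuous (F i)) -> continuous (fun t => \prod_(i <- r) F i t).
Proof.
move=> cF; elim: r => [|i r IH].
  by under eq_fun do rewrite big_nil; exact: cst_continuous.
under eq_fun do rewrite big_cons.
by apply: contM; [exact: cF|exact: IH].
Qed.

Lemma mcontM m n k (p : T -> 'M[R]_(m, n)) (q : T -> 'M[R]_(n, k)) :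
  mcont p -> mcont q -> mcont (fun t => p t *m q t).
Proof.
move=> cp cq i j; under eq_fun do rewrite mxE.
apply: continuous_sumR => l.
by apply: contM; [exact: cp|exact: cq].
Qed.

Lemma mcont_tr m n (p : T -> 'M[R]_(m, n)) : mcont p -> mcont (fun t => (p t)^T).
Proof. by move=> cp i j; under eq_fun do rewrite mxE; exact: cp. Qed.

Lemma mcont_block m1 m2 n1 n2 (a : T -> 'M[R]_(m1, n1)) (b : T -> 'M[R]_(m1, n2))
    (c : T -> 'M[R]_(m2, n1)) (d : T -> 'M[R]_(m2, n2)) :
  mcont a -> mcont b -> mcont c -> mcont d -> mcont (fun t => block_mx (a t) (b t) (c t) (d t)).
Proof.
move=> ca cb cc cd i j; rewrite -(splitK i) -(splitK j).
case: (fintype.split i) => i'; case: (fintype.split j) => j' /=.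
- by under eq_fun do rewrite block_mxEul; exact: ca.
- by under eq_fun do rewrite block_mxEur; exact: cb.
- by under eq_fun do rewrite block_mxEdl; exact: cc.
- by under eq_fun do rewrite block_mxEdr; exact: cd.
Qed.

Lemma continuous_det n (p : T -> 'M[R]_n) : mcont p -> continuous (fun t => \det (p t)).
Proof.
move=> cp; rewrite /determinant; apply: continuous_sumR => s.
apply: contM; first exact: cont_cst.
exact: continuous_prodR.
Qed.

Lemma mcont_inv n (p : T -> 'M[R]_n) : (forall t, p t \in unitmx) -> mcont p ->
  mcont (fun t => invmx (p t)).
Proof.
move=> up cp.
have -> : (fun t => invmx (p t)) = (fun t => (\det (p t))^-1 *: \adj (p t)).
  by apply/funext => t; rewrite /invmx up.
apply: mcontZ.
  apply: contV; last exact: continuous_det.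
  by move=> t; have := up t; rewrite unitmxE unitfE.
move=> i j; under eq_fun do rewrite mxE.
apply: contM; first exact: cont_cst.
apply: continuous_det => k l; under eq_fun do rewrite !mxE.
exact: cp.
Qed.

End Operations.

Lemma mcont_comp (T U : topologicalType) m n (f : T -> U) (p : U -> 'M[R]_(m, n)) :
  continuous f -> mcont p -> mcont (fun t => p (f t)).
Proof.
by move=> cf cp i j t; exact: (continuous_comp (cf t) (cp i j (f t))).
Qed.

Lemma cont_id : continuous (fun t : R => t).
Proof. by move=> t; exact: cvg_id. Qed.

(** Projection onto [0, 1], written with absolute values so that its continuity is that of the
    norm. *)
Definition clamp (t : R) : R := (1 + `|t| - `|t - 1|) / 2.

Lemma clampE t : 0 <= t <= 1 -> clamp t = t.
Proof.
move=> /andP[t0 t1]; rewrite /clamp ger0_norm// ler0_norm ?subr_le0//.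
by field.
Qed.

Lemma clamp_le0 t : t <= 0 -> clamp t = 0.
Proof.
move=> t0; rewrite /clamp ler0_norm// ler0_norm ?subr_le0 ?(le_trans t0)//.
by field.
Qed.

Lemma clamp_ge1 t : 1 <= t -> clamp t = 1.
Proof.
move=> t1; rewrite /clamp ger0_norm ?(le_trans _ t1)// ger0_norm ?subr_ge0//.
by field.
Qed.

Lemma clamp01 t : 0 <= clamp t <= 1.
Proof.
have [t0|/ltW t0] := leP t 0; first by rewrite clamp_le0// lexx ler01.
have [t1|/ltW t1] := leP t 1; first by rewrite clampE t0.
by rewrite clamp_ge1// ler01 lexx.
Qed.

Lemma clamp_continuous : continuous clamp.
Proof.
apply: contM; last exact: cont_cst.
apply: contB; first by apply: contD; [exact: cont_cst|exact: norm_continuous].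
move=> t; apply: (@continuous_comp _ _ _ (fun t : R => t - 1) (fun t : R => `|t|)).
  by apply: contB; [exact: cont_id|exact: cont_cst].
exact: norm_continuous.
Qed.

(* Paths are defined on the whole line; [clamp] retracts it onto [0, 1]. *)
Definition conn m n (S : set 'M[R]_(m, n)) (x y : 'M[R]_(m, n)) : Prop :=
  exists p : R -> 'M[R]_(m, n), [/\ mcont p, p 0 = x, p 1 = y & forall t, S (p t)].

Section Conn.
Variables (m n : nat) (S : set 'M[R]_(m, n)).

Lemma path_inE x y : @path_in R _ S x y <-> conn S x y.
Proof.
split=> [[p [cp [p0 [p1 pS]]]]|[p [/mcontP cp p0 p1 pS]]]; last first.
  by exists p; split; [exact: continuous_subspaceT|split; [|split]].
exists (p \o clamp); split.
- apply/mcontP => t; move/subspace_continuousP: cp => /(_ (clamp t)).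
  rewrite /= in_itv/= => /(_ (clamp01 t)) cp; apply: cvg_trans cp => A /= pA.
  have pA' : nbhs (clamp t) (fun x => `[0, 1]%classic x -> A (p x)) := pA.
  have H : \forall x \near t, `[0, 1]%classic (clamp x) -> A (p (clamp x)) := clamp_continuous pA'.
  suff : \forall x \near t, A (p (clamp x)) by [].
  apply: filterS H => z zA; apply: zA.
  by rewrite /= in_itv/=; exact: clamp01.
- by rewrite /= clamp_le0.
- by rewrite /= clamp_ge1.
- by move=> t /=; apply: pS; exact: clamp01.
Qed.

Lemma conn_refl x : S x -> conn S x x.
Proof. by move=> Sx; exists (fun=> x); split=> //; exact: mcont_cst. Qed.

Lemma conn_sym x y : conn S x y -> conn S y x.
Proof.
move=> [p [cp p0 p1 pS]]; exists (fun t => p (1 - t)); split=> //.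
- by apply: mcont_comp cp; apply: contB; [exact: cont_cst|exact: cont_id].
- by rewrite subr0.
- by rewrite subrr.
Qed.

(* Both paths are extended by constants; their sum minus the meeting point is the
   concatenation, so no continuous maps have to be glued. *)
Lemma conn_trans y x z : conn S x y -> conn S y z -> conn S x z.
Proof.
move=> [p [cp p0 p1 pS]] [q [cq q0 q1 qS]].
have cf (a b : R) : continuous (fun t => clamp (a * t + b)).
  move=> t; apply: (@continuous_comp _ _ _ (fun t => a * t + b) clamp).
    apply: contD; last exact: cont_cst.
    by apply: contM; [exact: cont_cst|exact: cont_id].
  exact: clamp_continuous.
exists (fun t => p (clamp (2 * t + 0)) + (q (clamp (2 * t + -1)) + - y)); split.
- apply: mcontD; first exact: mcont_comp cp.
  by apply: mcontD; [exact: mcont_comp cq|exact: mcont_cst].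
- by rewrite clamp_le0 ?mulr0 ?addr0// add0r clamp_le0 ?oppr_le0// p0 q0 subrr addr0.
- rewrite clamp_ge1; last by lra.
  by rewrite clamp_ge1 ?p1 ?q1; [rewrite addrC subrK|lra].
- move=> t; have [t2|/ltW t2] := leP t 2^-1.
    by rewrite [X in q X]clamp_le0 ?q0 ?subrr ?addr0//; lra.
  rewrite [X in p X]clamp_ge1 ?p1; last by lra.
  by rewrite addrC subrK.
Qed.

Lemma conn_segment x y : (forall t, 0 <= t <= 1 -> S ((1 - t) *: x + t *: y)) -> conn S x y.
Proof.
move=> H; exists (fun t => (1 - clamp t) *: x + clamp t *: y); split.
- apply: mcontD; apply: mcontZ; try exact: mcont_cst; last exact: clamp_continuous.
  by apply: contB; [exact: cont_cst|exact: clamp_continuous].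
- by rewrite clamp_le0// subr0 scale1r scale0r addr0.
- by rewrite clamp_ge1// subrr scale1r scale0r add0r.
- by move=> t; apply: H; exact: clamp01.
Qed.

End Conn.

End MatrixPaths.

(** * Path components of the general linear group *)

Section GeneralLinear.
Variable R : realType.

Local Notation GL := (conn (fun M => M \in unitmx)).

Lemma GLM n (M M' N N' : 'M[R]_n) : GL M M' -> GL N N' -> GL (M *m N) (M' *m N').
Proof.
move=> [p [cp p0 p1 pS]] [q [cq q0 q1 qS]]; exists (fun t => p t *m q t); split.
- exact: mcontM.
- by rewrite p0 q0.
- by rewrite p1 q1.
- by move=> t; rewrite unitmx_mul pS qS.
Qed.

(** A change of sign of the determinant along the path would force a zero by the intermediate value
    theorem. *)
Lemma GL_det_gt0 n (M N : 'M[R]_n) : GL M N -> 0 < \det M * \det N.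
Proof.
move=> [p [cp <- <- pS]].
have d0 t : \det (p t) != 0 by have := pS t; rewrite unitmxE unitfE.
have dd : continuous (fun t => \det (p t)) := continuous_det cp.
rewrite lt_neqAle eq_sym mulf_neq0//= leNgt; apply/negP => neg.
have [c _ /eqP] : exists2 c, c \in `[(0 : R), 1] & \det (p c) = 0.
  apply: IVT => //; first exact: continuous_subspaceT.
  rewrite ge_min le_max; have [a0|a0|a0] := ltrgtP 0 (\det (p 0)).
  - by move: neg; rewrite pmulr_rlt0// => /ltW ->; rewrite orbT.
  - by move: neg; rewrite nmulr_rlt0// => /ltW ->; rewrite orbT.
  - by have := d0 0; rewrite -a0 eqxx.
by rewrite (negPf (d0 c)).
Qed.

(** The segment stays triangular, and its diagonal entries interpolate between numbers of the same
    sign. *)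
Lemma GL_trig n (L M : 'M[R]_n) : is_trig_mx L -> is_trig_mx M ->
  (forall i, 0 < L i i * M i i) -> GL L M.
Proof.
move=> /is_trig_mxP tL /is_trig_mxP tM d; apply: conn_segment => t /andP[t0 t1] /=.
rewrite unitmxE unitfE det_trig; last first.
  by apply/is_trig_mxP => i j ij; rewrite !mxE tL// tM// !mulr0 addr0.
apply/prodf_neq0 => i _; rewrite !mxE; apply/eqP => z.
have := d i; move: z; move: (L i i) (M i i) => a b z ab.
have aa : 0 < a * a.
  by rewrite -expr2 exprn_even_gt0//=; apply/eqP => a0; rewrite a0 mul0r ltxx in ab.
(* Multiplying the entry by [a] makes both summands nonnegative, whatever the common sign. *)
have : (1 - t) * (a * a) + t * (a * b) = 0.
  by transitivity (a * ((1 - t) * a + t * b)); [ring|rewrite z mulr0].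
have h1 : 0 <= (1 - t) * (a * a) by rewrite mulr_ge0 ?subr_ge0// ltW.
move: t0; rewrite le_eqVlt => /predU1P[<-|t0].
  by rewrite subr0 mul1r mul0r addr0 => aa0; rewrite aa0 ltxx in aa.
by have := mulr_gt0 t0 ab; lra.
Qed.

Definition Fdiag n (i : 'I_n) (x : R) : 'M[R]_n := diag_mx (\row_j (if j == i then x else 1)).

Lemma Fdiag_sq n (i : 'I_n) : Fdiag i (-1) *m Fdiag i (-1) = 1%:M.
Proof.
rewrite /Fdiag mulmx_diag -diag_const_mx; congr diag_mx; apply/rowP => j; rewrite !mxE.
by case: eqP => _; rewrite ?mulrNN mulr1.
Qed.

Lemma diag_trig n (d : 'rV[R]_n) : is_trig_mx (diag_mx d).
Proof. by apply/is_trig_mxP => i j ij; rewrite !mxE -val_eqE /= ltn_eqF. Qed.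

Lemma GL_diag n (d e : 'rV[R]_n) : (forall i, 0 < d 0 i * e 0 i) -> GL (diag_mx d) (diag_mx e).
Proof.
move=> de; apply: GL_trig; [exact: diag_trig|exact: diag_trig|move=> i].
by rewrite !mxE eqxx !mulr1n; exact: de.
Qed.

Lemma GL_transvection n (i j : 'I_n) (x : R) : i != j -> GL (1%:M + x *: delta_mx i j) 1%:M.
Proof.
move=> ij; apply: conn_segment => t _ /=.
have -> : (1 - t) *: (1%:M + x *: delta_mx i j) + t *: 1%:M =
   1%:M + ((1 - t) * x) *: delta_mx i j :> 'M[R]_n.
  by rewrite scalerDr addrAC -scalerDl subrK scale1r scalerA.
move: ((1 - t) * x) => y.
have /mulmx1_unit[] // : (1%:M + y *: delta_mx i j) *m (1%:M - y *: delta_mx i j) = 1%:M :> 'M[R]_n.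
rewrite mulmxDl mul1mx mulmxBr mulmx1 -scalemxAl -scalemxAr mul_delta_mx_0 ?scaler0 ?subr0 ?subrK//.
by rewrite eq_sym.
Qed.

(** A transposition is a right-angle rotation times a sign change, and the rotation is a product of
    three transvections, each joined to the identity. *)
Lemma GL_tperm n (i j : 'I_n) : i != j -> GL (tperm_mx i j) (Fdiag j (-1)).
Proof.
move=> ij; have ji : j != i by rewrite eq_sym.
(* [w] is the rotation by a right angle in the plane of [i] and [j]. *)
pose w : 'M[R]_n := (1%:M + (-1) *: delta_mx i j) *m (1%:M + 1 *: delta_mx j i) *m
           (1%:M + (-1) *: delta_mx i j).
have wE : w = 1%:M - delta_mx i i - delta_mx j j + delta_mx j i - delta_mx i j.
  rewrite /w !mulmxDl !mulmxDr !mul1mx !mulmx1 scale1r !scaleN1r !mulNmx !mulmxN.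
  rewrite !(mulmxDl, mulNmx) !mul_delta_mx_cond !eqxx ?(negbTE ij) ?(negbTE ji).
  rewrite !mulr0n !mulr1n !mul1mx !mul_delta_mx_cond !eqxx ?(negbTE ij) ?(negbTE ji).
  rewrite ?mulr0n ?mulr1n.
  apply/matrixP => k l; rewrite !mxE; ring.
have -> : tperm_mx i j = w *m Fdiag j (-1).
  rewrite wE mul_mx_diag; apply/matrixP => k l; rewrite !mxE.
  rewrite ?(eq_sym _ l); case: tpermP => [->|->|/eqP ki /eqP kj];
  rewrite ?eqxx ?(negbTE ij) ?(negbTE ji) ?(negbTE ki) ?(negbTE kj) /= ?(eq_sym _ l);
  have [->|lj] := eqVneq l j;
  rewrite ?eqxx ?(negbTE ij) ?(negbTE ji) ?[j == k]eq_sym ?(negbTE kj) //=; try ring;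
  case: (l == i); case: (l == k) => /=; ring.
rewrite -[X in GL _ X]mul1mx; apply: GLM; last first.
  by apply: GL_diag => k; rewrite !mxE; case: eqP; rewrite ?mulrNN mulr1.
rewrite -[X in GL _ X]mul1mx; apply: GLM; last exact: GL_transvection.
by rewrite -[X in GL _ X]mul1mx; apply: GLM; exact: GL_transvection.
Qed.


(** The two candidate representatives, the identity and one reflection. The reflection is an
    involution, so the property is stable under products; a positive size provides the coordinate
    [ord0]. *)
Definition GLgood n (M : 'M[R]_n.+1) := GL M 1%:M \/ GL M (Fdiag ord0 (-1)).

Lemma GLgoodM n (M N : 'M[R]_n.+1) : GLgood M -> GLgood N -> GLgood (M *m N).
Proof.
move=> [gM|gM] [gN|gN]; have := GLM gM gN; rewrite ?mul1mx ?mulmx1 ?Fdiag_sq.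
- by left.
- by right.
- by right.
- by left.
Qed.

Lemma GLgood_Fdiag n (i : 'I_n.+1) x : x != 0 -> GLgood (Fdiag i x).
Proof.
move=> x0; have [xn|xp|xz] := ltrgtP x 0; last by rewrite xz eqxx in x0.
  right; apply: (@conn_trans _ _ _ _ (Fdiag i (-1))).
    by apply: GL_diag => j; rewrite !mxE; case: eqP; rewrite ?mulr1 ?ltr01// mulrN1 oppr_gt0.
  have [->|i0] := eqVneq i ord0.
    by apply: conn_refl; case: (mulmx1_unit (Fdiag_sq (ord0 : 'I_n.+1))).
  (* The same transposition is joined to the reflections at either of its two indices, so it carries
     one to the other. *)
  apply: (@conn_trans _ _ _ _ (tperm_mx ord0 i)).
    by apply: conn_sym; apply: GL_tperm; rewrite eq_sym.
  by rewrite /tperm_mx tpermC; exact: GL_tperm.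
left; rewrite -diag_const_mx; apply: GL_diag => j; rewrite !mxE.
by case: eqP; rewrite ?mulr1 ?ltr01.
Qed.

Lemma GLgood_diag n (d : 'rV[R]_n.+1) : (forall i, d 0 i != 0) -> GLgood (diag_mx d).
Proof.
move=> d0.
suff H (r : seq 'I_n.+1) : uniq r ->
    GLgood (diag_mx (\row_j (if j \in r then d 0 j else 1))).
  have := H _ (enum_uniq 'I_n.+1); congr (GLgood (diag_mx _)).
  by apply/rowP => j; rewrite mxE mem_enum.
elim: r => [_|k r IH /= /andP[kr ur]].
  left; have -> : \row_j (if j \in [::] then d 0 j else 1) = const_mx 1 :> 'rV[R]_n.+1.
    by apply/rowP => j; rewrite !mxE.
  by rewrite diag_const_mx; apply: conn_refl; exact: unitmx1.
have -> : diag_mx (\row_j (if j \in k :: r then d 0 j else 1)) =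
    Fdiag k (d 0 k) *m diag_mx (\row_j (if j \in r then d 0 j else 1)).
  rewrite mulmx_diag; congr diag_mx; apply/rowP => j; rewrite !mxE inE.
  by have [->|jk] := eqVneq j k; rewrite ?(negbTE kr) ?mulr1 ?mul1r.
by apply: GLgoodM; [exact: GLgood_Fdiag|exact: IH].
Qed.

Lemma GLgood_perm n (s : 'S_n.+1) : GLgood (perm_mx s : 'M[R]_n.+1).
Proof.
have [ts -> dts] := prod_tpermP s; elim: ts dts => [_|[i j] ts IH /= /andP[ij dts]].
  by left; rewrite big_nil perm_mx1; apply: conn_refl; exact: unitmx1.
rewrite big_cons perm_mxM; apply: GLgoodM; last exact: IH.
have n1 : (-1 : R) != 0 by rewrite oppr_eq0 oner_eq0.
have [g|g] := GLgood_Fdiag j n1.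
  by left; apply: conn_trans g; exact: GL_tperm.
by right; apply: conn_trans g; exact: GL_tperm.
Qed.

(** Through the LUP decomposition: the unipotent factor is joined to the identity, and the upper
    triangular one, by transposition, to its diagonal. *)
Lemma GLgood_unit n (M : 'M[R]_n.+1) : M \in unitmx -> GLgood M.
Proof.
move=> uM; have := cormen_lup_correct M; have := cormen_lup_perm M.
have := cormen_lup_detL M; have := @cormen_lup_lower _ _ M; have := @cormen_lup_upper _ _ M.
case: cormen_lup => [[P L] U] /= Uu Ll dL /is_perm_mxP[s Ps].
rewrite -!mulmxE => PM.
have ML : M = perm_mx (s^-1)%g *m (L *m U).
  by rewrite -PM Ps mulmxA -perm_mxM mulVg perm_mx1 mul1mx.
have uU : U \in unitmx.
  by move: uM; rewrite ML !unitmx_mul => /and3P[].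
have tU : is_trig_mx U^T by apply/is_trig_mxP => i j ij; rewrite mxE Uu.
have dU : \det U = \prod_i U i i.
  by rewrite -det_tr det_trig//; apply: eq_bigr => i _; rewrite mxE.
have U0 i : U i i != 0.
  by move: uU; rewrite unitmxE unitfE dU => /prodf_neq0; apply.
rewrite ML; apply: GLgoodM; first exact: GLgood_perm.
apply: GLgoodM.
  left; apply: GL_trig.
  - by apply/is_trig_mxP => i j ij; rewrite Ll ?(ltnW ij)// -val_eqE /= ltn_eqF.
  - by rewrite -diag_const_mx; exact: diag_trig.
  - by move=> i; rewrite Ll// eqxx mxE eqxx mulr1.
have cT (N : 'M[R]_n.+1) : GL U^T N -> GL U N^T.
  move=> [p [cp p0 p1 pS]]; exists (fun t => (p t)^T); split.
  - exact: mcont_tr.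
  - by rewrite p0 trmxK.
  - by rewrite p1.
  - by move=> t; rewrite unitmx_tr pS.
have gU : GL U (diag_mx (\row_j U j j)).
  rewrite -tr_diag_mx; apply: cT; apply: (GL_trig tU (diag_trig _)).
  by move=> i; rewrite !mxE eqxx mulr1n -expr2 exprn_even_gt0//= U0.
by have [g|g] := @GLgood_diag n (\row_j U j j) (fun i => ltac:(by rewrite mxE));
  [left|right]; exact: conn_trans gU g.
Qed.

Lemma GL_connected n (M N : 'M[R]_n) : 0 < \det M * \det N -> GL M N.
Proof.
move=> MN; have [M0 N0] : \det M != 0 /\ \det N != 0.
  by apply/andP; rewrite -negb_or -mulf_eq0 gt_eqF.
case: n M N MN M0 N0 => [|n] M N MN M0 N0.
  by rewrite (flatmx0 M) (flatmx0 N); apply: conn_refl; rewrite /= unitmxE det_mx00 unitr1.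
have uM : M \in unitmx by rewrite unitmxE unitfE.
have uN : N \in unitmx by rewrite unitmxE unitfE.
have J : \det (Fdiag (ord0 : 'I_n.+1) (-1)) = -1.
  rewrite det_diag (bigD1 ord0)//= mxE eqxx big1 ?mulr1// => i i0.
  by rewrite mxE (negbTE i0).
have [gM|gM] := GLgood_unit uM; have [gN|gN] := GLgood_unit uN.
- exact: conn_trans gM (conn_sym gN).
- have := GL_det_gt0 gM; have := GL_det_gt0 gN; rewrite J det1 mulr1 mulrN1 oppr_gt0 => Nn Mp.
  by move: MN; rewrite pmulr_rgt0// => /(lt_trans Nn); rewrite ltxx.
- have := GL_det_gt0 gM; have := GL_det_gt0 gN; rewrite J det1 mulr1 mulrN1 oppr_gt0 => Np Mn.
  by move: MN; rewrite pmulr_lgt0// => /(lt_trans Mn); rewrite ltxx.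
- exact: conn_trans gM (conn_sym gN).
Qed.

End GeneralLinear.

Section Invmx.
Variable R : realType.

Lemma invmx_uniq n (A B : 'M[R]_n) : A *m B = 1%:M -> invmx A = B.
Proof.
move=> AB; have [uA _] := mulmx1_unit AB.
by rewrite -[B](mulKmx uA) AB mulmx1.
Qed.

Lemma invmxM n (A B : 'M[R]_n) : A \in unitmx -> B \in unitmx ->
  invmx (A *m B) = invmx B *m invmx A.
Proof.
by move=> uA uB; apply: invmx_uniq; rewrite mulmxA mulmxK// mulmxV.
Qed.

End Invmx.

(** * The action of similarity transforms on controllers *)

Section ScrT.
Variables (R : realType) (nx nu ny : nat).
Implicit Types (K : 'M[R]_(nu + nx, ny + nx)) (T : 'M[R]_nx).

Lemma DK_scrT T K : DK (scrT T K) = DK K. Proof. exact: block_mxKul. Qed.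
Lemma CK_scrT T K : CK (scrT T K) = CK K *m invmx T. Proof. exact: block_mxKur. Qed.
Lemma BK_scrT T K : BK (scrT T K) = T *m BK K. Proof. exact: block_mxKdl. Qed.
Lemma AK_scrT T K : AK (scrT T K) = T *m AK K *m invmx T. Proof. exact: block_mxKdr. Qed.

Lemma scrT1 K : scrT 1%:M K = K.
Proof. by rewrite /scrT invmx1 !mulmx1 !mul1mx; exact: submxK. Qed.

Lemma scrTM T T' K : T \in unitmx -> T' \in unitmx ->
  scrT T (scrT T' K) = scrT (T *m T') K.
Proof.
move=> uT uT'; rewrite {1}/scrT DK_scrT CK_scrT BK_scrT AK_scrT.
by rewrite /scrT invmxM// !mulmxA.
Qed.

Lemma scrTK T K : T \in unitmx -> scrT (invmx T) (scrT T K) = K.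
Proof. by move=> uT; rewrite scrTM ?unitmx_inv// mulVmx// scrT1. Qed.

Lemma scrTVK T K : T \in unitmx -> scrT T (scrT (invmx T) K) = K.
Proof. by move=> uT; rewrite scrTM ?unitmx_inv// mulmxV// scrT1. Qed.

Lemma scrT_linear T a K K' : scrT T (a *: K + K') = a *: scrT T K + scrT T K'.
Proof.
have D : DK (a *: K + K') = a *: DK K + DK K' by apply/matrixP => i j; rewrite !mxE.
have C : CK (a *: K + K') = a *: CK K + CK K' by apply/matrixP => i j; rewrite !mxE.
have B : BK (a *: K + K') = a *: BK K + BK K' by apply/matrixP => i j; rewrite !mxE.
have A : AK (a *: K + K') = a *: AK K + AK K' by apply/matrixP => i j; rewrite !mxE.
rewrite /scrT D C B A scale_block_mx add_block_mx !mulmxDr !mulmxDl.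
by rewrite -!scalemxAr -!scalemxAl.
Qed.

Lemma mcont_scrT (X : topologicalType) (T : X -> 'M[R]_nx) (K : X -> 'M[R]_(nu + nx, ny + nx)) :
  (forall x, T x \in unitmx) -> mcont T -> mcont K -> mcont (fun x => scrT (T x) (K x)).
Proof.
move=> uT cT cK; have ciT := mcont_inv uT cT.
have cD : mcont (fun x => DK (K x)) by move=> i j; under eq_fun do rewrite !mxE; exact: cK.
have cC : mcont (fun x => CK (K x)) by move=> i j; under eq_fun do rewrite !mxE; exact: cK.
have cB : mcont (fun x => BK (K x)) by move=> i j; under eq_fun do rewrite !mxE; exact: cK.
have cA : mcont (fun x => AK (K x)) by move=> i j; under eq_fun do rewrite !mxE; exact: cK.
by apply: mcont_block => //; repeat apply: mcontM.
Qed.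

Lemma scrT_continuous T : T \in unitmx -> continuous (@scrT R nx nu ny T).
Proof.
move=> uT; apply/mcontP; apply: mcont_scrT => //; first exact: mcont_cst.
by move=> i j; exact: coord_continuous.
Qed.

End ScrT.

(** * The sublevel set as a set of solutions of matrix inequalities *)

Section LMI.
Variables (R : realType) (nx nu ny : nat).
Variables (A : 'M[R]_nx) (B2 : 'M[R]_(nx, nu)) (C2 : 'M[R]_(ny, nx)).
Variables (Wh Qh : 'M[R]_nx) (Vh : 'M[R]_ny) (Rh : 'M[R]_nu) (gamma : R).
Local Notation controller := 'M[R]_(nu + nx, ny + nx).
Implicit Types K : controller.
Local Notation Acl := (Acl A B2 C2).
Local Notation Bcl := (Bcl B2 Wh Vh).
Local Notation Ccl := (Ccl C2 Qh Rh).

Lemma AclE K : DK K = 0 -> Acl K = block_mx A (B2 *m CK K) (BK K *m C2) (AK K).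
Proof. by rewrite /Defs.Acl => ->; rewrite mulmx0 mul0mx addr0. Qed.

Lemma BclE K : DK K = 0 -> Bcl K = block_mx Wh 0 0 (BK K *m Vh).
Proof.
by rewrite /Defs.Bcl /D21 => ->; rewrite mulmx0 mul0mx addr0 mul_mx_row mulmx0.
Qed.

Lemma CclE K : DK K = 0 -> Ccl K = block_mx Qh 0 0 (Rh *m CK K).
Proof.
rewrite /Defs.Ccl /D12 => ->; rewrite mulmx0 mul0mx addr0 mul_col_mx mul0mx.
by rewrite block_mxEh.
Qed.

Definition lyap_res K (S : 'M[R]_(nx + nx)) := Acl K *m S + S *m (Acl K)^T + Bcl K *m (Bcl K)^T.

(** [S] is a strict supersolution of the Gramian equation: it dominates the Gramian, so the trace
    bound passes to the H2 norm, and strictness leaves room to perturb [S]. *)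
Definition lmi K (S : 'M[R]_(nx + nx)) := [/\ DK K = 0, pd S, pd (- lyap_res K S) &
  \tr (Ccl K *m S *m (Ccl K)^T) < gamma].

Lemma h2norm_sqE K S : DK K = 0 -> hurwitz (Acl K) ->
  Acl K *m S + S *m (Acl K)^T = - (Bcl K *m (Bcl K)^T) ->
  h2norm_sq A B2 C2 Wh Qh Vh Rh K = (\tr (Ccl K *m S *m (Ccl K)^T))%:E.
Proof.
move=> D0 hA HS; rewrite /h2norm_sq.
have TE w : Tzw A B2 C2 Wh Qh Vh Rh K w =
    mxC (Ccl K) *m invmx ((Complex 0 w)%:M - mxC (Acl K)) *m mxC (Bcl K).
  have D110 : mxC (D11 R nx nu ny) = 0 by rewrite mxCE /D11 map_mx0.
  by rewrite /Tzw /Dcl D0 mulmx0 mul0mx addr0 D110 addr0.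
under eq_integral do rewrite TE.
rewrite (h2_integral (Ccl K) hA HS) -EFinM mulrA mulVf ?mul1r//.
by rewrite gt_eqF// mulr_gt0// pi_gt0.
Qed.

(** The Gramian [X0] satisfies an equality and may be singular, so a small multiple of the solution
    [X1] for the right-hand side [- 1] is added. Conversely, [S - X0] solves a Lyapunov equation
    with positive definite data, so passing from [S] to [X0] does not increase the trace. *)
Lemma LgammaP K : Lgamma A B2 C2 Wh Qh Vh Rh gamma K <-> exists S, lmi K S.
Proof.
split=> [[/= hA [D0]]|[S [D0 pS pN trS]]].
  have [X0 HX0] := lyapunov_exists (Bcl K *m (Bcl K)^T) hA.
  have [X1 HX1] := lyapunov_exists 1%:M hA.
  rewrite (h2norm_sqE D0 hA HX0) lte_fin => t0.
  have pX1 := lyapunov_pd hA (pd1 _ _) HX1.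
  have t1 := tr_pd_ge0 (Ccl K) pX1.
  set a := \tr _ in t0; set b := \tr _ in t1.
  (* Then [e * (1 + b)] is half of the slack [gamma - a], so the added trace [e * b] stays below the
     slack. *)
  pose e := (gamma - a) / (1 + b) / 2.
  have b1 : 0 < 1 + b by rewrite ltr_pwDl.
  have e0 : 0 < e by rewrite !divr_gt0 ?subr_gt0.
  have HS : Acl K *m (X0 + e *: X1) + (X0 + e *: X1) *m (Acl K)^T =
      - (Bcl K *m (Bcl K)^T + e *: 1%:M).
    rewrite mulmxDr mulmxDl -scalemxAr -scalemxAl addrACA HX0 -scalerDr HX1.
    by rewrite scalerN opprD.
  exists (X0 + e *: X1); split=> //.
  - apply: lyapunov_pd hA _ HS; rewrite addrC; apply: pd_psdD; last exact: psd_mulT.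
    by apply: pdZ => //; exact: pd1.
  - rewrite /lyap_res HS opprD opprK [_ + e *: _]addrC addrK.
    by apply: pdZ => //; exact: pd1.
  - rewrite mulmxDr mulmxDl linearD /= -scalemxAr -scalemxAl linearZ /= -/a -/b.
    have eb : e * (1 + b) = (gamma - a) / 2 by rewrite /e mulrAC mulfVK ?gt_eqF.
    have : 0 < gamma - a by rewrite subr_gt0.
    by move: eb e0; rewrite mulrDr mulr1; move: (e * b) => eb; lra.
have hA : hurwitz (Acl K).
  apply: lyapunov_hurwitz pS _.
  have -> : - (Acl K *m S + S *m (Acl K)^T) = - lyap_res K S + Bcl K *m (Bcl K)^T.
    by rewrite /lyap_res [in RHS]opprD subrK.
  by apply: pd_psdD => //; exact: psd_mulT.
split=> //; split=> //; have [X0 HX0] := lyapunov_exists (Bcl K *m (Bcl K)^T) hA.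
rewrite (h2norm_sqE D0 hA HX0) lte_fin; apply: le_lt_trans trS.
have pD : pd (S - X0).
  apply: lyapunov_pd hA pN _.
  rewrite mulmxBr mulmxBl addrACA -opprD HX0 opprK opprK.
  by [].
have := tr_pd_ge0 (Ccl K) pD.
by rewrite mulmxBr mulmxBl linearB /= subr_ge0.
Qed.

Definition lmiset : set controller := [set K | exists S, lmi K S].

(** The transform is a change of the controller state, hence a congruence of [S] by
    [diag (1, T)]. *)
Lemma lmi_scrT T K S : T \in unitmx -> lmi K S ->
  lmi (scrT T K) (block_mx 1%:M 0 0 T *m S *m (block_mx 1%:M 0 0 T)^T).
Proof.
move=> uT [D0 pS pN trS]; set Th := block_mx _ _ _ _.
have uTh : Th \in unitmx by rewrite unitmxE det_ublock det1 mul1r -unitmxE.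
have D0' : DK (scrT T K) = 0 by rewrite DK_scrT.
have AT : Acl (scrT T K) *m Th = Th *m Acl K.
  rewrite !AclE// CK_scrT BK_scrT AK_scrT /Th !mulmx_block.
  by rewrite !mulmx0 !mul0mx !mulmx1 !mul1mx !addr0 !add0r -!mulmxA !mulVmx// !mulmx1.
have BT : Bcl (scrT T K) = Th *m Bcl K.
  rewrite !BclE// BK_scrT /Th !mulmx_block.
  by rewrite !mulmx0 !mul0mx !mul1mx !addr0 !add0r -!mulmxA.
have CT : Ccl (scrT T K) *m Th = Ccl K.
  rewrite !CclE// CK_scrT /Th !mulmx_block.
  by rewrite !mulmx0 !mul0mx !mulmx1 !addr0 !add0r -!mulmxA !mulVmx// !mulmx1.
have LT : lyap_res (scrT T K) (Th *m S *m Th^T) = Th *m lyap_res K S *m Th^T.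
  rewrite /lyap_res !mulmxA AT BT trmx_mul !mulmxDr !mulmxDl !mulmxA; congr (_ + _ + _).
  by rewrite -!mulmxA -!trmx_mul AT.
split=> //; first exact: pd_congr.
  by rewrite LT -mulNmx -mulmxN; exact: pd_congr.
by rewrite !mulmxA CT -!mulmxA -trmx_mul CT !mulmxA.
Qed.

Lemma lmiset_scrT T K : T \in unitmx -> lmiset K -> lmiset (scrT T K).
Proof. by move=> uT [S KS]; eexists; exact: lmi_scrT KS. Qed.

(** Moving along [E] adds [e] times the identity to the off-diagonal block, which is singular for
    finitely many [e] only. The radii [d1], [d2], [d3] protect the three strict inequalities. *)
Lemma lmi_perturb K S : lmi K S -> exists S', lmi K S' /\ ursubmx S' \in unitmx.
Proof.
move=> [D0 pS pN trS].
pose E : 'M[R]_(nx + nx) := block_mx 0 1%:M 1%:M 0.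
have Es : E^T = E by rewrite /E tr_block_mx !trmx0 !trmx1.
pose N := - (Acl K *m E + E *m (Acl K)^T).
have Ns : N^T = N.
  by rewrite /N linearN linearD /= !trmx_mul trmxK Es addrC.
have [d1 d10 H1] := pd_open pS Es.
have [d2 d20 H2] := pd_open pN Ns.
set a := \tr _ in trS; pose b := \tr (Ccl K *m E *m (Ccl K)^T).
pose d3 := (gamma - a) / (1 + `|b|).
have b1 : 0 < 1 + `|b| by rewrite ltr_pwDl.
have d30 : 0 < d3 by rewrite divr_gt0// subr_gt0.
pose d := Num.min d1 (Num.min d2 d3).
have d0 : 0 < d by rewrite !lt_min d10 d20.
have [e /andP[e0]] := unit_perturb (ursubmx S) d0.
rewrite !lt_min => /and3P[e1 e2 e3] uS; exists (S + e *: E); split.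
  split=> //.
  - by apply: H1; rewrite ltW.
  - have -> : - lyap_res K (S + e *: E) = - lyap_res K S + e *: N.
      rewrite /N scalerN -opprD /lyap_res; congr (- _).
      rewrite mulmxDr mulmxDl -scalemxAr -scalemxAl.
      move: (Acl K *m S) (Acl K *m E) (S *m (Acl K)^T) (E *m (Acl K)^T) (Bcl K *m (Bcl K)^T).
      by move=> P1 P2 P3 P4 P5; apply/matrixP => i j; rewrite !mxE; ring.
    by apply: H2; rewrite ltW.
  - rewrite mulmxDr mulmxDl linearD /= -scalemxAr -scalemxAl linearZ /= -/a -/b.
    have eb : e * b <= e * `|b| by apply: ler_wpM2l; [exact: ltW|exact: ler_norm].
    move: e3; rewrite ltr_pdivlMr// mulrDr mulr1.
    by move: eb; move: (e * b) (e * `|b|) => p q; lra.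
have -> : ursubmx (S + e *: E) = ursubmx S + e%:M.
  have -> : ursubmx (S + e *: E) = ursubmx S + e *: ursubmx E.
    by apply/matrixP => i j; rewrite !mxE.
  by rewrite block_mxKur scalemx1.
by [].
Qed.

Lemma lmi_normal_form K : lmiset K -> exists T K0 S0,
  [/\ T \in unitmx, K = scrT T K0, lmi K0 S0, ursubmx S0 = 1%:M & dlsubmx S0 = 1%:M].
Proof.
move=> [S0 /lmi_perturb[S [KS uS]]].
(* The congruence multiplies the upper right block by [T^T] on the right, so this choice turns it
   into the identity. *)
pose T := invmx (ursubmx S)^T.
have uT : T \in unitmx by rewrite unitmx_inv unitmx_tr.
have uiT : invmx T \in unitmx by rewrite unitmx_inv.
exists (invmx T), (scrT T K); eexists; split; first exact: uiT.
- by rewrite scrTK.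
- exact: lmi_scrT KS.
- rewrite -{1}(submxK S) tr_block_mx !mulmx_block block_mxKur.
  rewrite !(trmx0, trmx1, mulmx0, mul0mx, mul1mx, mulmx1, addr0, add0r).
  by rewrite /T trmx_inv trmxK mulmxV.
- have [_ [Ss _] _ _] := KS.
  rewrite -{1}(submxK S) tr_block_mx !mulmx_block block_mxKdl.
  rewrite !(trmx0, trmx1, mulmx0, mul0mx, mul1mx, mulmx1, addr0, add0r).
  by rewrite -Ss -trmx_ursub mulVmx// unitmx_tr.
Qed.

(** * Linearizing change of variables *)

Section ChangeOfVariables.
Variables (X Y : 'M[R]_nx).

(* Scherer's linearizing change of variables. The closed-loop Gramian S has blocks
   [[X, 1], [1, Z]], its inverse has first block column [[Y], [1 - X Y]], so that
   S *m var_right = var_left and var_gram = var_left^T *m S^-1 *m var_left.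
   [var_S], [var_B] and [var_C] are the compressions of the closed-loop matrices,
   affine in (X, Y, Ah, Bh, Ch). *)
Definition var_gram : 'M[R]_(nx + nx) := block_mx X 1%:M 1%:M Y.
Definition var_left : 'M[R]_(nx + nx) := block_mx X 1%:M 1%:M 0.
Definition var_right : 'M[R]_(nx + nx) := block_mx 1%:M Y 0 (1%:M - X *m Y).

Definition var_S (Ah : 'M[R]_nx) (Bh : 'M[R]_(nx, ny)) (Ch : 'M[R]_(nu, nx)) : 'M[R]_(nx + nx) :=
  block_mx (A *m X + B2 *m Ch) A Ah (Y *m A + Bh *m C2).
Definition var_B (Bh : 'M[R]_(nx, ny)) : 'M[R]_(nx + nx, nx + ny) :=
  block_mx Wh 0 (Y *m Wh) (Bh *m Vh).
Definition var_C (Ch : 'M[R]_(nu, nx)) : 'M[R]_(nx + nu, nx + nx) :=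
  block_mx (Qh *m X) Qh (Rh *m Ch) 0.
(** The relations of [var_closed_loop] solved for the controller. *)
Definition var_K (Ah : 'M[R]_nx) (Bh : 'M[R]_(nx, ny)) (Ch : 'M[R]_(nu, nx)) : controller :=
  let Ni := invmx (1%:M - Y *m X) in
  block_mx 0 Ch (Ni *m Bh) (Ni *m (Ah - Y *m A *m X - Bh *m C2 *m X - Y *m B2 *m Ch)).

(** The conditions of [lmi] after congruence by [var_right]. The trace becomes a matrix fractional
    function of the affine pair ([var_C], [var_gram]). *)
Definition var_lmi Ah Bh Ch := [/\ pd var_gram,
  pd (- (var_S Ah Bh Ch + (var_S Ah Bh Ch)^T + var_B Bh *m (var_B Bh)^T)) &
  \tr (var_C Ch *m invmx var_gram *m (var_C Ch)^T) < gamma].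

Lemma var_left_inv : var_left *m block_mx 0 1%:M 1%:M (- X) = 1%:M.
Proof.
rewrite /var_left mulmx_block !(mulmx0, mul0mx, mulmx1, mul1mx, addr0, add0r) subrr.
by rewrite -scalar_mx_block.
Qed.

Lemma var_left_unit : var_left \in unitmx.
Proof. by have [] := mulmx1_unit var_left_inv. Qed.

Hypotheses (Xs : X^T = X) (Ys : Y^T = Y).

Lemma var_left_tr : var_left^T = var_left.
Proof. by rewrite /var_left tr_block_mx !trmx1 trmx0 Xs. Qed.

Lemma var_gramE : var_left^T *m var_right = var_gram.
Proof.
rewrite var_left_tr /var_left /var_right mulmx_block.
rewrite !(mulmx0, mul0mx, mulmx1, mul1mx, addr0, add0r).
by rewrite addrC subrK.
Qed.

Lemma var_right_unit : var_gram \in unitmx -> var_right \in unitmx.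
Proof. by rewrite -var_gramE unitmx_mul => /andP[]. Qed.

Lemma var_N_unit : var_right \in unitmx -> 1%:M - Y *m X \in unitmx.
Proof.
rewrite unitmxE det_ublock det1 mul1r -unitmxE -unitmx_tr.
by rewrite linearB /= trmx1 trmx_mul Xs Ys.
Qed.

Lemma var_closed_loop K : DK K = 0 ->
  let N := 1%:M - Y *m X in let Ch := CK K in let Bh := N *m BK K in
  let Ah := N *m AK K + Y *m B2 *m Ch + Bh *m C2 *m X + Y *m A *m X in
  [/\ var_right^T *m Acl K *m var_left = var_S Ah Bh Ch,
      var_right^T *m Bcl K = var_B Bh & Ccl K *m var_left = var_C Ch].
Proof.
move=> D0 N Ch Bh Ah.
have rT : var_right^T = block_mx 1%:M 0 Y N.
  by rewrite /var_right tr_block_mx trmx1 trmx0 Ys linearB /= trmx1 trmx_mul Xs Ys.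
split.
- rewrite rT AclE// /var_left /var_S !mulmx_block.
  rewrite !(mulmx0, mul0mx, mulmx1, mul1mx, addr0, add0r); congr block_mx; last by rewrite mulmxA.
  rewrite mulmxDl /Ah /Bh /Ch !mulmxA.
  move: (Y *m A *m X) (N *m BK K *m C2 *m X) (Y *m B2 *m CK K) (N *m AK K) => P1 P2 P3 P4.
  by apply/matrixP => i j; rewrite !mxE; ring.
- by rewrite rT BclE// /var_B mulmx_block !(mulmx0, mul0mx, mulmx1, mul1mx, addr0, add0r) mulmxA.
- by rewrite CclE// /var_left /var_C mulmx_block !(mulmx0, mul0mx, mulmx1, mul1mx, addr0, add0r).
Qed.

Lemma var_lyap_res K S Ah Bh Ch : S^T = S -> S *m var_right = var_left ->
  var_right^T *m Acl K *m var_left = var_S Ah Bh Ch ->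
  var_right^T *m Bcl K = var_B Bh ->
  var_right^T *m lyap_res K S *m var_right =
  var_S Ah Bh Ch + (var_S Ah Bh Ch)^T + var_B Bh *m (var_B Bh)^T.
Proof.
move=> Ss Sr <- <-; rewrite /lyap_res !mulmxDr !mulmxDl !trmx_mul trmxK -{1 2}Sr !trmx_mul Ss.
by rewrite !mulmxA.
Qed.

Lemma lmi_of_var Ah Bh Ch : var_lmi Ah Bh Ch -> lmiset (var_K Ah Bh Ch).
Proof.
move=> [pH pN trH]; have uH := pd_unit pH; have ur := var_right_unit uH.
have uN := var_N_unit ur; have [Hs _] := pH.
set K := var_K _ _ _.
have D0 : DK K = 0 by exact: block_mxKul.
have KC : CK K = Ch by exact: block_mxKur.
have KB : BK K = invmx (1%:M - Y *m X) *m Bh by exact: block_mxKdl.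
have KA : AK K = invmx (1%:M - Y *m X) *m (Ah - Y *m A *m X - Bh *m C2 *m X - Y *m B2 *m Ch).
  exact: block_mxKdr.
have [] := var_closed_loop D0; rewrite /= KC KB KA !mulKVmx// !subrK => SE BE CE.
(* Forced by [S *m var_right = var_left] together with [var_gramE]. *)
pose S := var_left *m invmx var_gram *m var_left^T.
have pS : pd S by apply: pd_congr; [exact: pd_inv|exact: var_left_unit].
have Sr : S *m var_right = var_left by rewrite /S -mulmxA var_gramE mulmxKV.
exists S; split=> //.
  have [Ss _] := pS; rewrite -(var_lyap_res Ss Sr SE BE) in pN.
  have uirT : invmx var_right^T \in unitmx by rewrite unitmx_inv unitmx_tr.
  have := pd_congr pN uirT.
  rewrite trmx_inv trmxK mulmxN mulNmx !mulmxA mulVmx ?unitmx_tr// mul1mx.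
  by rewrite mulmxK.
by rewrite /S !mulmxA CE -!mulmxA -trmx_mul CE !mulmxA.
Qed.

End ChangeOfVariables.

Lemma var_of_lmi K S : lmi K S -> ursubmx S = 1%:M -> dlsubmx S = 1%:M ->
  exists X Y Ah Bh Ch, [/\ X^T = X, Y^T = Y, var_lmi X Y Ah Bh Ch & K = var_K X Y Ah Bh Ch].
Proof.
move=> [D0 pS pN trS] S12 S21; have [Ss _] := pS; have uS := pd_unit pS.
have [Ps _] := pd_inv pS.
pose X := ulsubmx S; pose Z := drsubmx S; pose Y := ulsubmx (invmx S).
have SE : S = block_mx X 1%:M 1%:M Z by rewrite -{1}(submxK S) S12 S21.
have Xs : X^T = X by rewrite /X trmx_ulsub Ss.
have Ys : Y^T = Y by rewrite /Y trmx_ulsub Ps.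
(* The first block column of [S S^-1 = 1] gives [X Y + P21 = 1] and [Y + Z P21 = 0], with [P21] the
   lower left block of [S^-1]. *)
have := mulmxV uS; rewrite -{1}(submxK (invmx S)) {1}SE mulmx_block scalar_mx_block.
move=> /eq_block_mx[]; rewrite -/Y !mul1mx => XY _ YZ _.
have P21 : dlsubmx (invmx S) = 1%:M - X *m Y by rewrite -XY addrAC subrr add0r.
rewrite P21 in YZ.
have Sr : S *m var_right X Y = var_left X.
  rewrite {1}SE /var_right mulmx_block !(mulmx0, mul0mx, mulmx1, mul1mx, addr0, add0r).
  by rewrite YZ addrC subrK.
have ur : var_right X Y \in unitmx.
  by have := var_left_unit X; rewrite -Sr unitmx_mul => /andP[].
have uN := var_N_unit Xs Ys ur.
have gE : var_gram X Y = (var_right X Y)^T *m S *m var_right X Y.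
  by rewrite -(var_gramE Y Xs) -Sr trmx_mul Ss.
have pH : pd (var_gram X Y).
  by rewrite gE -{2}(trmxK (var_right X Y)); apply: pd_congr => //; rewrite unitmx_tr.
have [HS HB HC] := var_closed_loop Xs Ys D0.
pose N := 1%:M - Y *m X.
exists X, Y, (N *m AK K + Y *m B2 *m CK K + N *m BK K *m C2 *m X + Y *m A *m X).
exists (N *m BK K), (CK K).
split=> //.
  split; first exact: pH.
  - rewrite -(var_lyap_res Ss Sr HS HB).
    rewrite -mulNmx -mulmxN -{2}(trmxK (var_right X Y)).
    by apply: pd_congr => //; rewrite unitmx_tr.
  - have <- : Ccl K *m S *m (Ccl K)^T =
       var_C X (CK K) *m invmx (var_gram X Y) *m (var_C X (CK K))^T.
      rewrite -HC -Sr gE -mulmxA !invmxM ?unitmx_mul ?unitmx_tr ?ur ?uS//.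
      rewrite !trmx_mul Ss !mulmxA mulmxK// mulmxK// -[_ *m invmx _^T *m _]mulmxA.
      by rewrite mulVmx ?unitmx_tr// mulmx1.
    exact: trS.
rewrite /var_K !addrK !mulKmx// -{1}(submxK K).
by congr block_mx; exact: D0.
Qed.

(* Equality holds at V = H^-1 G^T, so tr (G H^-1 G^T) is a supremum of functions affine
   in (G, H), hence convex. *)
Lemma matrix_fractional n m (G : 'M[R]_(m, n)) (H : 'M[R]_n) (V : 'M[R]_(n, m)) : pd H ->
  2 * \tr (G *m V) - \tr (V^T *m H *m V) <= \tr (G *m invmx H *m G^T).
Proof.
move=> pH; have uH := pd_unit pH; have [Hs _] := pH.
have := tr_pd_ge0 (V^T - G *m invmx H) pH.
have -> : (V^T - G *m invmx H)^T = V - invmx H *m G^T.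
  by rewrite linearB /= trmxK trmx_mul trmx_inv Hs.
rewrite mulmxBl mulmxBr !mulmxBl mulmxKV// -[V^T *m H *m (_ *m _)]mulmxA mulKVmx//.
have tE : \tr (V^T *m G^T) = \tr (G *m V) by rewrite -trmx_mul mxtrace_tr.
rewrite raddfB /= !raddfB /= tE mulmxA.
by move: (\tr (V^T *m H *m V)) (\tr (G *m V)) (\tr (G *m invmx H *m G^T)) => p q r; lra.
Qed.

(** * Convexity of the inequalities in the linearizing variables *)

Section Convexity.
Variables (X0 Y0 Ah0 X1 Y1 Ah1 : 'M[R]_nx) (Bh0 Bh1 : 'M[R]_(nx, ny)) (Ch0 Ch1 : 'M[R]_(nu, nx)).
Hypotheses (L0 : var_lmi X0 Y0 Ah0 Bh0 Ch0) (L1 : var_lmi X1 Y1 Ah1 Bh1 Ch1).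
Local Notation cvx t M N := ((1 - t) *: M + t *: N).

Lemma var_gram_cvx t :
  var_gram (cvx t X0 X1) (cvx t Y0 Y1) = cvx t (var_gram X0 Y0) (var_gram X1 Y1).
Proof.
by rewrite /var_gram !scale_block_mx add_block_mx -!scalerDl subrK !scale1r.
Qed.

Lemma var_C_cvx t : var_C (cvx t X0 X1) (cvx t Ch0 Ch1) = cvx t (var_C X0 Ch0) (var_C X1 Ch1).
Proof.
by rewrite /var_C !scale_block_mx add_block_mx !mulmxDr -!scalemxAr -!scalerDl subrK !scale1r.
Qed.

Lemma var_B_cvx t : var_B (cvx t Y0 Y1) (cvx t Bh0 Bh1) = cvx t (var_B Y0 Bh0) (var_B Y1 Bh1).
Proof.
by rewrite /var_B !scale_block_mx add_block_mx !mulmxDl -!scalemxAl -!scalerDl subrK !scale1r.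
Qed.

Lemma var_S_cvx t :
  var_S (cvx t X0 X1) (cvx t Y0 Y1) (cvx t Ah0 Ah1) (cvx t Bh0 Bh1) (cvx t Ch0 Ch1) =
  cvx t (var_S X0 Y0 Ah0 Bh0 Ch0) (var_S X1 Y1 Ah1 Bh1 Ch1).
Proof.
rewrite /var_S !scale_block_mx add_block_mx -!scalerDl subrK !scale1r.
rewrite !mulmxDl !mulmxDr -!scalemxAl -!scalemxAr !scalerDr.
by congr block_mx; rewrite addrACA.
Qed.

Lemma var_lmi_cvx t : 0 <= t <= 1 ->
  var_lmi (cvx t X0 X1) (cvx t Y0 Y1) (cvx t Ah0 Ah1) (cvx t Bh0 Bh1) (cvx t Ch0 Ch1).
Proof.
move=> t01; have /andP[t0 t1] := t01; have [pH0 pN0 tr0] := L0; have [pH1 pN1 tr1] := L1.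
have pH := pd_convex t01 pH0 pH1.
rewrite /var_lmi var_gram_cvx var_C_cvx var_B_cvx var_S_cvx; split=> //.
- move: (pd_convex t01 pN0 pN1).
  set S0 := var_S _ _ _ _ _; set S1 := var_S _ _ _ _ _; set b0 := var_B _ _; set b1 := var_B _ _.
  move=> pN.
  (* Convexity of [b -> b b^T] with its exact defect [t (1 - t) (b0 - b1) (b0 - b1)^T], which is
     positive semidefinite. *)
  have -> : - (cvx t S0 S1 + (cvx t S0 S1)^T + cvx t b0 b1 *m (cvx t b0 b1)^T) =
     cvx t (- (S0 + S0^T + b0 *m b0^T)) (- (S1 + S1^T + b1 *m b1^T)) +
     (t * (1 - t)) *: ((b0 - b1) *m (b0 - b1)^T).
    have trE m n (a c : R) (M N : 'M[R]_(m, n)) : (a *: M + c *: N)^T = a *: M^T + c *: N^T.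
      by rewrite linearD !linearZ.
    have trB m n (M N : 'M[R]_(m, n)) : (M - N)^T = M^T - N^T by rewrite linearB.
    rewrite !trE trB !mulmxDl !mulmxDr !(mulNmx, mulmxN) -!scalemxAl -!scalemxAr.
    move: (S0^T) (S1^T) (b0 *m b0^T) (b0 *m b1^T) (b1 *m b0^T) (b1 *m b1^T) => P1 P2 P3 P4 P5 P6.
    by apply/matrixP => i j; rewrite !mxE; ring.
  apply: pd_psdD => //; apply: psdZ; last exact: psd_mulT.
  by rewrite mulr_ge0// subr_ge0.
- set H0 := var_gram _ _ in pH0 tr0 pH *; set H1 := var_gram _ _ in pH1 tr1 pH *.
  set G0 := var_C _ _ in tr0 *; set G1 := var_C _ _ in tr1 *.
  set H := cvx t H0 H1 in pH *; set G := cvx t G0 G1.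
  (* The maximizer for the interpolated pair: equality holds there, while at the endpoints the same
     [V] gives lower bounds of the traces. *)
  pose V := invmx H *m G^T; have uH := pd_unit pH; have [Hs _] := pH.
  have f0 := matrix_fractional G0 V pH0; have f1 := matrix_fractional G1 V pH1.
  have VHV : V^T *m H *m V = G *m V.
    by rewrite /V trmx_mul trmxK trmx_inv Hs -mulmxA mulKVmx// mulmxA.
  have GV : \tr (G *m V) = (1 - t) * \tr (G0 *m V) + t * \tr (G1 *m V).
    by rewrite /G mulmxDl -!scalemxAl raddfD /= !mxtraceZ.
  have HV : \tr (V^T *m H *m V) =
      (1 - t) * \tr (V^T *m H0 *m V) + t * \tr (V^T *m H1 *m V).
    by rewrite /H mulmxDr mulmxDl -!scalemxAr -!scalemxAl raddfD /= !mxtraceZ.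
  have -> : \tr (G *m invmx H *m G^T) = 2 * \tr (G *m V) - \tr (V^T *m H *m V).
    by rewrite VHV -mulmxA -/V; ring.
  rewrite GV HV; move: f0 f1 tr0 tr1.
  move: (\tr (G0 *m V)) (\tr (G1 *m V)) (\tr (V^T *m H0 *m V)) (\tr (V^T *m H1 *m V)).
  move: (\tr (G0 *m _ *m _)) (\tr (G1 *m _ *m _)) => a0 a1 g0 g1 v0 v1 f0 f1 tr0 tr1.
  have q0 : (1 - t) * (2 * g0 - v0) <= (1 - t) * a0 by rewrite ler_wpM2l// subr_ge0.
  have q1 : t * (2 * g1 - v1) <= t * a1 by rewrite ler_wpM2l.
  have : (1 - t) * a0 + t * a1 < gamma; last by lra.
  (* The endpoint [t = 0] is separate because strictness is drawn from the second summand. *)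
  have [->|tn0] := eqVneq t 0; first by rewrite subr0 mul1r mul0r addr0.
  have tp : 0 < t by rewrite lt_neqAle eq_sym tn0.
  have q2 : (1 - t) * a0 <= (1 - t) * gamma by rewrite ler_wpM2l ?subr_ge0// ltW.
  have q3 : t * a1 < t * gamma by rewrite ltr_pM2l.
  by lra.
Qed.

Hypotheses (X0s : X0^T = X0) (Y0s : Y0^T = Y0) (X1s : X1^T = X1) (Y1s : Y1^T = Y1).

(** The image under [var_K] of the segment. Definiteness of [var_gram] keeps [1 - Y X] invertible
    along it, so the image is continuous. *)
Lemma var_K_conn : conn lmiset (var_K X0 Y0 Ah0 Bh0 Ch0) (var_K X1 Y1 Ah1 Bh1 Ch1).
Proof.
pose q m n (M N : 'M[R]_(m, n)) (t : R) := cvx (clamp t) M N.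
have cq m n (M N : 'M[R]_(m, n)) : mcont (q _ _ M N).
  apply: mcontD; apply: mcontZ; try exact: mcont_cst; last exact: clamp_continuous.
  by apply: contB; [exact: cont_cst|exact: clamp_continuous].
have q0 m n (M N : 'M[R]_(m, n)) : q _ _ M N 0 = M.
  by rewrite /q clamp_le0// subr0 scale1r scale0r addr0.
have q1 m n (M N : 'M[R]_(m, n)) : q _ _ M N 1 = N.
  by rewrite /q clamp_ge1// subrr scale0r scale1r add0r.
have qs (M N : 'M[R]_nx) t : M^T = M -> N^T = N -> (q _ _ M N t)^T = q _ _ M N t.
  by move=> Ms Ns; rewrite /q linearD !linearZ /= Ms Ns.
have L t := var_lmi_cvx (clamp01 t).
have uN t : 1%:M - q _ _ Y0 Y1 t *m q _ _ X0 X1 t \in unitmx.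
  have [pH _ _] := L t.
  apply: var_N_unit; [exact: qs|exact: qs|].
  by apply: var_right_unit; [exact: qs|exact: pd_unit pH].
exists (fun t => var_K (q _ _ X0 X1 t) (q _ _ Y0 Y1 t) (q _ _ Ah0 Ah1 t)
                       (q _ _ Bh0 Bh1 t) (q _ _ Ch0 Ch1 t)).
split; last 1 first.
- by move=> t; apply: lmi_of_var; [exact: qs|exact: qs|exact: L].
- have cN : mcont (fun t => invmx (1%:M - q _ _ Y0 Y1 t *m q _ _ X0 X1 t)).
    apply: mcont_inv => //; apply: mcontD; first exact: mcont_cst.
    by apply: mcontN; apply: mcontM; exact: cq.
  have cst m n (M : 'M[R]_(m, n)) : mcont (fun _ : R => M) by exact: mcont_cst.
  apply: mcont_block => //; first exact: mcontM.
  apply: mcontM => //.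
  have cMM m1 m2 m3 m4 (M0 M1 : 'M[R]_(m1, m2)) (N : 'M[R]_(m2, m3)) (P0 P1 : 'M[R]_(m3, m4)) :
      mcont (fun t => - (q _ _ M0 M1 t *m N *m q _ _ P0 P1 t)).
    by apply: mcontN; apply: mcontM; [apply: mcontM; [exact: cq|exact: cst]|exact: cq].
  by apply: mcontD (cMM _ _ _ _ _ _ _ _ _); apply: mcontD (cMM _ _ _ _ _ _ _ _ _);
    apply: mcontD (cMM _ _ _ _ _ _ _ _ _); exact: cq.
- by rewrite !q0.
- by rewrite !q1.
Qed.

End Convexity.

(** * Path components as orbits of the similarity action *)

Lemma lmiset_normal_conn K K' : lmiset K -> lmiset K' -> exists T T',
  [/\ T \in unitmx, T' \in unitmx & conn lmiset (scrT T K) (scrT T' K')].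
Proof.
move=> /lmi_normal_form[T [K0 [S [uT -> KS S12 S21]]]].
move=> /lmi_normal_form[T' [K0' [S' [uT' -> KS' S12' S21']]]].
have [X [Y [Ah [Bh [Ch [Xs Ys L KE]]]]]] := var_of_lmi KS S12 S21.
have [X' [Y' [Ah' [Bh' [Ch' [Xs' Ys' L' KE']]]]]] := var_of_lmi KS' S12' S21'.
exists (invmx T), (invmx T'); split; rewrite ?unitmx_inv// !scrTK// KE KE'.
exact: var_K_conn.
Qed.

Lemma conn_scrT T K K' : T \in unitmx -> conn lmiset K K' ->
  conn lmiset (scrT T K) (scrT T K').
Proof.
move=> uT [p [cp <- <- pS]]; exists (fun t => scrT T (p t)); split=> //.
- by apply: mcont_scrT => //; exact: mcont_cst.
- by move=> t; exact: lmiset_scrT.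
Qed.

Lemma conn_scrT_GL T T' K : lmiset K -> 0 < \det T * \det T' ->
  conn lmiset (scrT T K) (scrT T' K).
Proof.
move=> LK /GL_connected[p [cp <- <- pS]]; exists (fun t => scrT (p t) K); split=> //.
- by apply: mcont_scrT => //; exact: mcont_cst.
- by move=> t; exact: lmiset_scrT.
Qed.

Lemma lmiset_orbit K K' : lmiset K -> lmiset K' ->
  exists2 T, T \in unitmx & conn lmiset (scrT T K) K'.
Proof.
move=> LK LK'; have [T [T' [uT uT' c]]] := lmiset_normal_conn LK LK'.
exists (invmx T' *m T); first by rewrite unitmx_mul unitmx_inv uT'.
have uiT' : invmx T' \in unitmx by rewrite unitmx_inv.
by have := conn_scrT uiT' c; rewrite scrTK// scrTM.
Qed.

(** An orbit splits by the sign of the determinant. For an empty set any two controllers serve;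
    without a matrix of negative determinant, as for [nx = 0], one component covers everything. *)
Lemma lmiset_two_components : exists K1 K2, forall K, lmiset K ->
  conn lmiset K1 K \/ conn lmiset K2 K.
Proof.
have [[K0 LK0]|none] := pselect (exists K, lmiset K); last first.
  by exists 0, 0 => K LK; case: none; exists K.
have [[J Jneg]|noJ] := pselect (exists J : 'M[R]_nx, \det J < 0).
  exists K0, (scrT J K0) => K /(lmiset_orbit LK0)[T uT c].
  move: (uT); rewrite unitmxE unitfE neq_lt => /orP[Tn|Tp].
    by right; apply: conn_trans c; apply: conn_scrT_GL; rewrite // nmulr_rgt0.
  left; apply: conn_trans c; rewrite -{1}(scrT1 K0).
  by apply: conn_scrT_GL; rewrite // det1 mul1r.
exists K0, K0 => K /(lmiset_orbit LK0)[T uT c]; left.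
move: (uT); rewrite unitmxE unitfE neq_lt => /orP[Tn|Tp]; first by case: noJ; exists T.
apply: conn_trans c; rewrite -{1}(scrT1 K0).
by apply: conn_scrT_GL; rewrite // det1 mul1r.
Qed.

(** If [scrT T K1] stayed in the component of [K1], transforms of [K1] of both signs would lie
    there, and [lmiset_orbit] would put [K2] there as well. *)
Lemma lmiset_scrT_swap K1 K2 T : lmiset K1 -> lmiset K2 -> ~ conn lmiset K1 K2 ->
  (forall K, lmiset K -> conn lmiset K1 K \/ conn lmiset K2 K) -> \det T < 0 ->
  conn lmiset K2 (scrT T K1).
Proof.
move=> LK1 LK2 nc cov Tneg.
have uT : T \in unitmx by rewrite unitmxE unitfE lt_eqF.
have [c1|//] := cov _ (lmiset_scrT uT LK1).
exfalso; apply: nc; have [T2 uT2 c2] := lmiset_orbit LK1 LK2.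
apply: conn_trans c2; move: (uT2); rewrite unitmxE unitfE neq_lt => /orP[T2n|T2p].
  by apply: (conn_trans c1); apply: conn_scrT_GL; rewrite // nmulr_rgt0.
rewrite -{1}(scrT1 K1).
by apply: conn_scrT_GL; rewrite // det1 mul1r.
Qed.

End LMI.

Theorem theorem4 (R : realType) (nx nu ny : nat)
    (A : 'M[R]_nx) (B2 : 'M[R]_(nx, nu)) (C2 : 'M[R]_(ny, nx))
    (W Wh Q Qh : 'M[R]_nx) (V Vh : 'M[R]_ny) (Rw Rh : 'M[R]_nu) :
  psd W -> pd V -> psd Q -> pd Rw ->
  is_psd_sqrt Wh W -> is_psd_sqrt Vh V -> is_psd_sqrt Qh Q -> is_psd_sqrt Rh Rw ->
  controllable A B2 -> controllable A Wh -> observable C2 A -> observable Qh A ->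
  forall gamma : R, 0 < gamma ->
  let L := Lgamma A B2 C2 Wh Qh Vh Rh gamma in
  (* at most two path-connected components *)
  (exists K1 K2 : 'M[R]_(nu + nx, ny + nx),
     forall K, L K -> @path_in R _ L K1 K \/ @path_in R _ L K2 K) /\
  (* if there are exactly two components L1 (of K1) and L2 (of K2), then
     for every T with det T < 0, scrT T is a diffeomorphism mapping L1 onto L2
     (a linear bijection of the controller space with inverse scrT T^{-1}) *)
  (forall K1 K2 : 'M[R]_(nu + nx, ny + nx),
     L K1 -> L K2 -> ~ @path_in R _ L K1 K2 ->
     (forall K, L K -> @path_in R _ L K1 K \/ @path_in R _ L K2 K) ->
     forall T : 'M[R]_nx, \det T < 0 ->
       @scrT R nx nu ny T @` (@path_component R _ L K1) = @path_component R _ L K2 /\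
       (forall K : 'M[R]_(nu + nx, ny + nx), scrT (invmx T) (scrT T K) = K) /\
       (forall K : 'M[R]_(nu + nx, ny + nx), scrT T (scrT (invmx T) K) = K) /\
       (forall (a : R) (K K' : 'M[R]_(nu + nx, ny + nx)),
          scrT T (a *: K + K') = a *: scrT T K + scrT T K') /\
       continuous (@scrT R nx nu ny T) /\
       continuous (@scrT R nx nu ny (invmx T))).
Proof.
move=> _ _ _ _ _ _ _ _ _ _ _ _ gamma _ L.
have -> : L = lmiset A B2 C2 Wh Qh Vh Rh gamma.
  by apply/funext => K; apply/propext; exact: LgammaP.
have [K1 [K2 cov]] := lmiset_two_components A B2 C2 Wh Qh Vh Rh gamma.
split.
  by exists K1, K2 => K /cov[] c; [left|right]; apply/path_inE.
move=> {K1 K2 cov} K1 K2 LK1 LK2 nc cov T Tneg.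
have uT : T \in unitmx by rewrite unitmxE unitfE lt_eqF.
have uiT : invmx T \in unitmx by rewrite unitmx_inv.
have nc' : ~ conn (lmiset A B2 C2 Wh Qh Vh Rh gamma) K1 K2 by move=> /path_inE.
have cov' K : lmiset A B2 C2 Wh Qh Vh Rh gamma K ->
    conn (lmiset A B2 C2 Wh Qh Vh Rh gamma) K1 K \/ conn (lmiset A B2 C2 Wh Qh Vh Rh gamma) K2 K.
  by move=> /cov[] /path_inE; [left|right].
have swap := lmiset_scrT_swap LK1 LK2 nc' cov'.
split; last first.
  split; first by move=> K; exact: scrTK.
  split; first by move=> K; exact: scrTVK.
  split; first by move=> a K K'; exact: scrT_linear.
  by split; exact: scrT_continuous.
apply/seteqP; split=> [_ [K [_ /path_inE cK] <-]|K [_ /path_inE cK]].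
  split=> //; apply/path_inE; apply: conn_trans (swap _ Tneg) _.
  exact: conn_scrT.
have iTneg : \det (invmx T) < 0 by rewrite det_inv invr_lt0.
exists (scrT (invmx T) K); last exact: scrTVK.
(* Applying [invmx T] to the path from [K2] to [scrT T K1] joins [scrT (invmx T) K2] to [K1]. *)
split=> //; apply/path_inE; apply: (conn_trans (y := scrT (invmx T) K2)).
  have := conn_sym (conn_scrT uiT (swap _ Tneg)); rewrite scrTK//.
exact: conn_scrT.
Qed.
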